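(* Let $n\ge 2$, let $\gamma$ be the reflection representation of $\mathfrak{S}_n$, and let $p(j)$ denote the number of partitions of the integer $j$. Then \[ K(\gamma)\cong\bigoplus_{i=2}^{p(n)-p(n-1)}\mathbb{Z}/q_i\mathbb{Z},\qquad\text{where}\qquad q_i=\prod_{\substack{1\le j\le n\\ p(j)-p(j-1)\ge i}} j. \] (An empty direct sum is the trivial group.)
   Context: Let $G$ be a finite group with irreducible complex characters $\chi_0,\chi_1,\dots,\chi_\ell$, where $\chi_0$ is the trivial character. For a faithful $d$-dimensional complex representation $\gamma$ of $G$ with character $\chi_\gamma$, let $M=(m_{ij})\in\mathbb{Z}^{(\ell+1)\times(\ell+1)}$ be defined by $\chi_\gamma\cdot\chi_i=\sum_{j=0}^{\ell}m_{ij}\chi_j$. The extended McKay–Cartan matrix is $\tilde C:=dI-M$, and the McKay–Cartan matrix $C$ is the $\ell\times\ell$ matrix obtained from $\tilde C$ by deleting the row and column indexed by $\chi_0$. The critical group of $\gamma$ is $K(\gamma):=\operatorname{coker}(C^t:\mathbb{Z}^\ell\to\mathbb{Z}^\ell)$. The reflection representation of $\mathfrak{S}_n$ is the $(n-1)$-dimensional irreducible representation indexed by the partition $(n-1,1)$, i.e. the permutation representation of $\mathfrak{S}_n$ on $\mathbb{C}^n$ with its trivial summand removed; it is faithful for $n\ge2$. By convention $p(0)=1$. *)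

(* Defs.v *)
From HB Require Import structures.
From mathcomp Require Import all_boot all_order all_algebra all_fingroup all_solvable all_field all_character.
Set Implicit Arguments. Unset Strict Implicit. Unset Printing Implicit Defensive.
Import Order.TTheory GRing.Theory Num.Theory.
Local Open Scope ring_scope.

(** Number of partitions of j: non-increasing sequences of positive integers
    summing to j, encoded (bijectively) as non-increasing j-tuples with entries
    in {0..j}, padded by zeros, summing to j.  p 0 = 1. *)
Definition npart (j : nat) : nat :=
  #|[pred t : j.-tuple 'I_j.+1 |
      sorted geq [seq val x | x <- t] && (sumn [seq val x | x <- t] == j)]|.

Definition Sn_group (n : nat) : {group 'S_n} := [set: 'S_n]%G.

Lemma perm_mx_repr (n : nat) :
  mx_repr (Sn_group n) (fun s : 'S_n => (perm_mx s : 'M[algC]_n)).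
Proof.
split; first exact: perm_mx1.
by move=> s t _ _; rewrite /= perm_mxM.
Qed.

Definition perm_repr (n : nat) : mx_representation algC (Sn_group n) n :=
  MxRepresentation (perm_mx_repr n).

Definition refl_char (n : nat) : 'CF(Sn_group n) := cfRepr (perm_repr n) - 1.

(** Given the integer matrix M of the McKay multiplicities
    (chi_gamma * chi_i = sum_j M i j chi_j, indexed by Iirr, with 'chi_0 = 1),
    the McKay-Cartan matrix C: delete row/column 0 of d*I - M. *)
Definition mckay_cartan (gT : finGroupType) (G : {group gT}) (d : nat)
  (M : 'M[int]_(Nirr G)) : 'M[int]_((Nirr G).-1) :=
  \matrix_(i, j) ((d%:Z)%:M - M) (lift 0 i) (lift 0 j).

(** coker (A : Z^l -> Z^l, acting on column vectors) is isomorphic to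
    (+)_{i<k} Z/q_i Z : there is a group homomorphism (an integer matrix F)
    Z^l -> Z^k which, composed with reduction modulo q componentwise, is
    surjective onto (+) Z/q_i and whose kernel is exactly the image of A. *)
Definition coker_iso (l k : nat) (A : 'M[int]_l) (q : 'I_k -> int) : Prop :=
  exists F : 'M[int]_(k, l),
    (forall t : 'cV[int]_k, exists x : 'cV[int]_l,
        forall i, ((F *m x) i ord0 == t i ord0 %[mod q i])%Z) /\
    (forall x : 'cV[int]_l,
        (forall i, (q i %| (F *m x) i ord0)%Z) <-> exists z : 'cV[int]_l, x = A *m z).

Definition qfac (n i : nat) : nat :=
  (\prod_(1 <= j < n.+1 | (i <= npart j - npart j.-1)%N) j)%N.

Arguments Sn_group n : clear implicits.
Arguments perm_repr n : clear implicits.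
Arguments refl_char n : clear implicits.

(* Main.v *)
Require Import Defs.
From HB Require Import structures.
From mathcomp Require Import all_boot all_order all_algebra all_fingroup all_solvable all_field all_character.
From mathcomp Require Import zify.
Set Implicit Arguments. Unset Strict Implicit. Unset Printing Implicit Defensive.
Import Order.TTheory GRing.Theory Num.Theory.

(** The operator d*I - M is multiplication by n - chi_perm on the lattice of
    virtual characters, chi_perm being the permutation character.  The Young
    characters h_s (s a partition of n; h_s counts the colourings of content s
    fixed by a permutation) form a Z-basis of this lattice: there are at most p(n)
    irreducible characters, and the pairing of h_s with sign * h_t', where t' is the
    conjugate of t, counts 0-1 matrices with row sums s and column sums t', hence is
    unitriangular for the dominance order.  Multiplication by chi_perm, called X,
    acts on them by "lower one part by 1 and add a part 1" (Pieri and branching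
    rule).

    Since X lowers parts one at a time, solving (X - k) p = q by recursion on the
    largest part gives a second, unitriangular basis g_s with
      X g_s = m_1(s) g_s + g_(nxt s),
    where nxt lowers the largest part and adds a part 1, and g_(nxt s) is read as 0
    when the largest part is 1 or repeated.  So n - X splits into chains, one for
    each partition s without part 1; in the cokernel g_(nxt s) = (n - m_1(s)) g_s,
    and a chain of length m contributes Z/(n (n-1) ... (n-m+1)), with
    m = s_1 - s_2 + 1, except for the chain of s = (n), which contributes Z.
    The number of s with n - j <= s_1 - s_2 is p(j) - p(j-1) for 2 <= j <= n, and
    ordering the chains by s_1 - s_2 yields the q_i.  Deleting the row and column
    of the trivial character removes the summand Z, because the vector of
    degrees spans the left and right kernels. *)

(** * Partitions *)

Definition is_part (n : nat) (s : seq nat) :=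
  [&& sorted geq s, all (leq 1) s & sumn s == n].

(** The padded tuples counted by [npart] with their zeros erased, so that the size is [npart n] by
    construction. *)
Definition parts (n : nat) : seq (seq nat) :=
  [seq [seq m <- [seq val x | x <- tval t] | 0 < m] |
     t in [pred t : n.-tuple 'I_n.+1 |
       sorted geq [seq val x | x <- t] && (sumn [seq val x | x <- t] == n)]].

Lemma geq_trans : transitive geq.
Proof. by move=> a b c /= ab bc; apply: leq_trans bc ab. Qed.

Lemma geq_anti : antisymmetric geq.
Proof. by move=> a b /= ab; apply/eqP; rewrite eqn_leq andbC. Qed.

Lemma is_part_cons n a s :
  is_part n (a :: s) =
  [&& 0 < a, a <= n, all (geq a) s & is_part (n - a) s].
Proof.
rewrite /is_part /= path_sortedE; last exact: geq_trans.
case: (all (geq a) s) => /=; last by rewrite !andbF.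
case: (sorted geq s) => /=; last by rewrite !andbF.
by case: (all (leq 1) s) => /=; lia.
Qed.

Lemma sumn_filter_pos s : sumn [seq m <- s | 0 < m] = sumn s.
Proof. by elim: s => //= -[|a] s IH /=; rewrite ?IH. Qed.

Lemma sorted_pad s k : sorted geq (s ++ nseq k 0) = sorted geq s.
Proof.
rewrite !(sorted_pairwise geq_trans) pairwise_cat.
have -> : allrel geq s (nseq k 0).
  by apply/allrelP => x y _ /nseqP[-> _].
have -> : pairwise geq (nseq k 0).
  by elim: k => //= k ->; rewrite andbT; apply/allP => y /nseqP[-> _].
by rewrite andbT.
Qed.

Lemma sorted_filter_pos s :
  sorted geq s -> s = [seq m <- s | 0 < m] ++ nseq (count_mem 0 s) 0.
Proof.
move=> ss; apply: (sorted_eq geq_trans geq_anti) => //.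
  by rewrite sorted_pad sorted_filter //; exact: geq_trans.
apply/seq.permP => p; rewrite count_cat.
rewrite count_nseq; elim: s {ss} => [|[|a] s IH] /=; rewrite ?muln0 ?IH /=; lia.
Qed.

Lemma size_part n s : is_part n s -> size s <= n.
Proof.
elim: s n => //= a s IH n; rewrite is_part_cons => /and4P[a0 an _ /IH]; lia.
Qed.

Lemma part_leq n s x : is_part n s -> x \in s -> x <= n.
Proof.
elim: s n => //= a s IH n; rewrite is_part_cons inE => /and4P[a0 an _ /IH h].
by case/orP=> [/eqP->//|/h]; lia.
Qed.

Lemma part_nth_leq n s i : is_part n s -> nth 0 s i <= n.
Proof.
move=> ps; case: (ltnP i (size s)) => h; last by rewrite nth_default.
by apply: part_leq ps _; apply: mem_nth.
Qed.

Lemma mem_parts n s : (s \in parts n) = is_part n s.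
Proof.
apply/imageP/idP => [[t /andP[st /eqP sumt] ->]|ps].
  rewrite /is_part sumn_filter_pos sumt eqxx andbT sorted_filter //; last exact: geq_trans.
  by rewrite filter_all.
pose u := s ++ nseq (n - size s) 0.
have su : size u = n by rewrite size_cat size_nseq subnKC // (size_part ps).
have ub x : x \in u -> x < n.+1.
  by rewrite mem_cat => /orP[/(part_leq ps)//|/nseqP[->]].
have e : [seq val x | x <- [seq inord x : 'I_n.+1 | x <- u]] = u.
  rewrite -map_comp -[RHS]map_id; apply/eq_in_map => x xu /=.
  by rewrite inordK // ub.
have st : size [seq inord x : 'I_n.+1 | x <- u] == n by rewrite size_map su.
exists (Tuple st); rewrite ?inE /= e.
  have/and3P[ss sp /eqP sn] := ps.
  rewrite sumn_cat sumn_nseq mul0n addn0 sn eqxx andbT.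
  by rewrite /u sorted_pad ss.
rewrite /u filter_cat.
have/and3P[ss sp /eqP sn] := ps.
rewrite (all_filterP _) //; set r := filter _ _.
suff -> : r = [::] by rewrite cats0.
by rewrite /r; elim: (n - size s).
Qed.

Lemma parts_uniq n : uniq (parts n).
Proof.
rewrite map_inj_in_uniq ?enum_uniq // => t u.
rewrite !mem_enum !inE => /andP[st _] /andP[su _] e.
apply/val_inj/(inj_map val_inj) => /=.
rewrite (sorted_filter_pos st) (sorted_filter_pos su) e; congr (_ ++ nseq _ _).
(* The number of padding zeros is forced by the length n, so the positive entries determine the
   tuple. *)
have sz (v : n.-tuple 'I_n.+1) : sorted geq [seq val x | x <- v] ->
    size [seq m <- [seq val x | x <- v] | 0 < m] + count_mem 0 [seq val x | x <- v] = n.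
  move=> sv; rewrite -[RHS](size_tuple v) -(size_map val).
  by rewrite {3}(sorted_filter_pos sv) size_cat size_nseq.
by have := sz t st; rewrite e => h; apply: (addnI (etrans h (esym (sz u su)))).
Qed.

Lemma size_parts n : size (parts n) = npart n.
Proof. by rewrite size_map -cardE. Qed.

(** * Chains of partitions under [nxt] and [up], each starting at a [top] *)

Definition top (s : seq nat) : seq nat :=
  if [seq x <- s | 1 < x] is a :: s' then a + count_mem 1 s :: s'
  else [:: count_mem 1 s].

Definition nxt (s : seq nat) : seq nat :=
  if s is a :: s' then a.-1 :: rcons s' 1 else [::].

Definition up (s : seq nat) : seq nat :=
  if s is a :: s' then a.+1 :: rem 1 s' else [::].

(** The chain continues below s: the lowered first part stays positive and at least as large as the
    second one. *)
Definition desc (s : seq nat) : bool :=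
  if s is a :: s' then (1 < a) && (head 0 s' < a) else false.

Definition gap (s : seq nat) : nat := head 0 s - nth 0 s 1.

(** The multiple of g_(top s) that g_s becomes in the cokernel: the product of the factors n - m_1
    met on the way down from [top s]. *)
Definition weight (n : nat) (s : seq nat) : nat := n ^_ (count_mem 1 s).

(** The order of g_s in the cokernel for a chain start s; 0 encodes the infinite cyclic summand of
    the chain of (n). *)
Definition modulus (n : nat) (s : seq nat) : nat :=
  if s == [:: n] then 0 else n ^_ (gap s).+1.

Lemma is_part_sorted n s : is_part n s -> sorted geq s.
Proof. by case/and3P. Qed.

Lemma is_part_pos n s : is_part n s -> all (leq 1) s.
Proof. by case/and3P. Qed.

Lemma is_part_sum n s : is_part n s -> sumn s = n.
Proof. by case/and3P=> _ _ /eqP. Qed.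

Lemma part_all_ones n s : is_part n s -> all (geq 1) s -> s = nseq n 1.
Proof.
elim: s n => [|a s IH] n; first by move/is_part_sum => /= <-.
rewrite is_part_cons => /and4P[a0 an _ ps] /= /andP[a1 s1].
have -> : a = 1 by lia.
rewrite (IH _ ps s1); have {2}-> : n = (n - a).+1 by lia.
by [].
Qed.

Lemma part_ones n s :
  is_part n s -> s = [seq x <- s | 1 < x] ++ nseq (count_mem 1 s) 1.
Proof.
elim: s n => [|a s IH] n //; rewrite is_part_cons => /and4P[a0 an sa ps].
case: (ltnP 1 a) => a1 /=.
  have -> : (a == 1) = false by lia.
  by rewrite add0n a1 {1}(IH _ ps).
have ea : a = 1 by lia.
rewrite ea in sa *; rewrite (part_all_ones ps sa) /= count_nseq /= mul1n.
by rewrite (_ : [seq x <- _ | _] = [::]) //; elim: (n - a).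
Qed.

Lemma part_mem_pos n s x : is_part n s -> x \in s -> 0 < x.
Proof. by move/is_part_pos/allP => h /h. Qed.

Lemma part_head_leq n a s x : is_part n (a :: s) -> x \in s -> x <= a.
Proof. by rewrite is_part_cons => /and4P[_ _ /allP h _] /h. Qed.

Lemma part_head0_leq n a s x : is_part n (a :: s) -> x \in s -> x <= head 0 s.
Proof.
rewrite is_part_cons => /and4P[_ _ _]; case: s => //= b s ps.
by rewrite inE => /orP[/eqP->//|/(part_head_leq ps)].
Qed.

Lemma is_part_sort n s : all (leq 1) s -> sumn s = n -> is_part n (sort geq s).
Proof.
move=> sp sn; apply/and3P; split.
- by apply: sort_sorted => a b /=; lia.
- by rewrite all_sort.
- by rewrite -sn; apply/eqP/perm_sumn; rewrite perm_sort.
Qed.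

Lemma part_eq n m s t : is_part n s -> is_part m t -> perm_eq s t -> s = t.
Proof.
move=> /is_part_sorted ss /is_part_sorted st; exact: (sorted_eq geq_trans geq_anti).
Qed.

Lemma sorted_rcons1 s : sorted geq s -> all (leq 1) s -> sorted geq (rcons s 1).
Proof.
move=> ss sp; rewrite -cats1 (sorted_pairwise geq_trans) pairwise_cat /=.
rewrite -(sorted_pairwise geq_trans) ss !andbT.
by apply/allrelP => x y xs; rewrite inE => /eqP ->; apply: (allP sp).
Qed.

Lemma nxt_part n s : is_part n s -> desc s -> is_part n (nxt s).
Proof.
case: s => // a s ps /= /andP[a1 hs].
have := ps; rewrite !is_part_cons => /and4P[a0 an sa ps'].
apply/and4P; split; [lia|lia| |].
  rewrite all_rcons /=; apply/andP; split; first lia.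
  by apply/allP => x /(part_head0_leq ps) /=; lia.
apply/and3P; split.
- by apply: sorted_rcons1; [apply: is_part_sorted ps'|apply: is_part_pos ps'].
- by rewrite all_rcons (is_part_pos ps').
- by rewrite sumn_rcons (is_part_sum ps'); lia.
Qed.

Lemma desc2 n s : is_part n (2 :: s) -> desc (2 :: s) -> s = nseq (n - 2) 1.
Proof.
move=> ps /= hs; have := ps; rewrite is_part_cons => /and4P[_ _ _ ps'].
by apply: part_all_ones ps' _; apply/allP => x /(part_head0_leq ps) /=; lia.
Qed.

Lemma filter_ones k : [seq x <- nseq k 1 | 1 < x] = [::].
Proof. by elim: k. Qed.

Lemma count_ones k : count_mem 1 (nseq k 1) = k.
Proof. by rewrite count_nseq mul1n. Qed.

Lemma nxt2 n s : is_part n (2 :: s) -> desc (2 :: s) -> nxt (2 :: s) = nseq n 1.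
Proof.
move=> ps ds; have := ps; rewrite is_part_cons => /and4P[_ n2 _ _].
rewrite /= (desc2 ps ds) -cats1 -[[:: 1]]/(nseq 1 1) -nseqD addn1.
by have {2}-> : n = (n - 2).+2 by lia.
Qed.

(** What [nxt] takes off the largest part is put back by [top] as a 1. The step from a largest part
    2 is separate: it creates two parts 1 at once and leads to the all-ones partition. *)
Lemma top_nxt n s : is_part n s -> desc s -> top (nxt s) = top s.
Proof.
case: s => // a s ps ds; have /= /andP[a1 _] := ds.
case: (ltngtP a 2) => [|a2|ea]; first lia.
  rewrite /top /= a1 (_ : 1 < a.-1); last lia.
  rewrite filter_rcons /= -cats1 count_cat /=.
  by rewrite (_ : a == 1 = false) 1?(_ : a.-1 == 1 = false); [congr (_ :: _)| |]; lia.
rewrite ea in ps ds *; rewrite -[2.-1 :: _]/(nxt (2 :: s)) (nxt2 ps ds) (desc2 ps ds) /top filter_ones /=.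
rewrite filter_ones !count_ones; have := ps; rewrite is_part_cons => /and4P[_ n2 _ _].
congr [:: _]; lia.
Qed.

(** One more part 1 appends the factor n - m_1 to the falling factorial. When the largest part is 2,
    m_1 jumps from n - 2 to n, and the second new factor is 1. *)
Lemma weight_nxt n s : is_part n s -> desc s ->
  weight n (nxt s) = (n - count_mem 1 s) * weight n s.
Proof.
case: s => // a s ps ds; have /= /andP[a1 _] := ds.
case: (ltngtP a 2) => [|a2|ea]; first lia.
  rewrite /weight /= -cats1 count_cat /=.
  rewrite (_ : a == 1 = false) 1?(_ : a.-1 == 1 = false); try lia.
  by rewrite !add0n !addn0 addn1 ffactnSr mulnC.
rewrite ea in ps ds *; rewrite -[2.-1 :: _]/(nxt (2 :: s)) (nxt2 ps ds) (desc2 ps ds) /weight /= add0n.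
rewrite !count_ones; have := ps; rewrite is_part_cons => /and4P[_ n2 _ _].
have [m em] : exists m, m = n - 2 by exists (n - 2).
rewrite -em; have {2}-> : n = m.+2 by lia.
have h2 : n - m = 2 by lia.
have h1 : n - m.+1 = 1 by lia.
by rewrite !ffactnSr h2 h1 muln1 mulnC.
Qed.

(** At the end of a chain whose first part exceeds 1, the first two parts agree, so the gap of the
    top is m_1 and its falling factorial has one factor more than the weight. The all-ones partition
    ends the chain of (n), and there n - m_1 = 0 matches the modulus 0. *)
Lemma modulus_bottom n s : 1 < n -> is_part n s -> ~~ desc s ->
  modulus n (top s) = (n - count_mem 1 s) * weight n s.
Proof.
case: s => [|a s] n1 ps; first by move/is_part_sum: ps => /=; lia.
have := ps; rewrite is_part_cons => /and4P[a0 an sa ps'] /=.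
case: (ltnP 1 a) => a1 /=.
  case: s sa ps ps' => [|b s] sa ps ps' /=; first lia.
  rewrite -leqNgt => ab; have eb : b = a by move: sa => /= /andP[/=]; lia.
  rewrite eb in ps ps' *.
  rewrite /top /= a1 /modulus /gap /weight /=.
  rewrite (_ : a == 1 = false); last lia.
  by rewrite !add0n addKn ffactnSr mulnC; case: eqP.
have ea : a = 1 by lia.
rewrite ea in sa ps *; move=> _.
have e : 1 :: s = nseq n 1.
  by apply: part_all_ones ps _.
have -> : 1 + count_mem 1 s = n by rewrite -(count_ones n) -e.
by rewrite e /top filter_ones count_ones /modulus eqxx subnn.
Qed.

Lemma top_id n s : 0 < n -> is_part n s -> 1 \notin s -> top s = s.
Proof.
move=> n0 ps h; have e : count_mem 1 s = 0 by apply/count_memPn.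
have := part_ones ps; rewrite e cats0 => es; rewrite /top -es e.
by case: s ps {h e es} => [/is_part_sum /= h|a s _]; [lia|rewrite addn0].
Qed.

Lemma weight_id n s : 1 \notin s -> weight n s = 1.
Proof. by move=> h; rewrite /weight (_ : count_mem 1 s = 0) //; apply/count_memPn. Qed.

Lemma part_gt1 n s : is_part n s -> 1 \notin s -> all (leq 2) s.
Proof.
move=> ps h; apply/allP => x xs; have := part_mem_pos ps xs.
by case: (x =P 1) => [e|]; [rewrite -e xs in h|lia].
Qed.

Lemma top_part n s : 1 < n -> is_part n s -> is_part n (top s) /\ 1 \notin top s.
Proof.
move=> n1 ps; have es := part_ones ps; rewrite /top.
have sf : sorted geq [seq x <- s | 1 < x].
  by apply: sorted_filter (is_part_sorted ps); exact: geq_trans.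
have af : all (leq 2) [seq x <- s | 1 < x] by rewrite filter_all.
have sum : sumn [seq x <- s | 1 < x] + count_mem 1 s = n.
  by rewrite -(is_part_sum ps) {3}es sumn_cat sumn_nseq mul1n.
have af1 : all (leq 1) [seq x <- s | 1 < x].
  by apply: sub_all af => x /=; lia.
case: [seq x <- s | 1 < x] sf af af1 sum => [|a f] /= sf af af1 sum.
  by rewrite /is_part /= inE; split; apply/idP; lia.
rewrite /is_part /= inE negb_or.
move: sf af af1; rewrite !path_sortedE; try exact: geq_trans.
move=> /andP[af' sf] /andP[a2 af] /andP[_ af1]; rewrite sf af1; split.
  rewrite andbT; apply/and3P; split; try lia.
  by apply: sub_all af' => x /=; lia.
apply/andP; split; first lia.
by apply/negP => /(allP af).
Qed.

(** As n > 1, a part 1 can be taken from the tail even of the all-ones partition; hence every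
    partition with a part 1 is a successor in its chain. *)
Lemma up_part n s : 1 < n -> is_part n s -> 1 \in s ->
  [/\ is_part n (up s), 1 \in behead s, desc (up s),
      perm_eq (1 :: rem 1 (behead s)) (behead s) & nxt (up s) = s].
Proof.
case: s => [|a s] n1 ps //= h.
have := ps; rewrite is_part_cons => /and4P[a0 an sa ps'].
have h1 : 1 \in s.
  move: h; rewrite inE => /orP[/eqP ea|//].
  rewrite -ea /= in sa ps'; rewrite (part_all_ones ps' sa).
  by rewrite (_ : n - 1 = (n - 2).+1) ?mem_head //; lia.
have pe : perm_eq (1 :: rem 1 s) s by rewrite perm_sym perm_to_rem.
have sr : sorted geq (rem 1 s).
  by apply: subseq_sorted (rem_subseq _ _) (is_part_sorted ps'); exact: geq_trans.
have ar (x : nat) : x \in rem 1 s -> x \in s by apply: mem_rem.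
have pu : is_part n (a.+1 :: rem 1 s).
  have := perm_sumn pe; rewrite /= (is_part_sum ps') => e.
  rewrite is_part_cons; apply/and4P; split; try lia.
    by apply/allP => x /ar /(allP sa) /=; lia.
  apply/and3P; split=> //; last lia.
  by apply/allP => x /ar /(allP (is_part_pos ps')).
have du : head 0 (rem 1 s) < a.+1.
  case E: (rem 1 s) => [|b r] //=.
  have /ar/(allP sa) /= : b \in rem 1 s by rewrite E mem_head.
  by lia.
have du' : desc (up (a :: s)) by rewrite /= du; lia.
split=> //; have := nxt_part pu du' => pn.
apply: (part_eq pn ps); rewrite /= perm_cons perm_rcons; exact: pe.
Qed.

Lemma count_up n s : 1 < n -> is_part n s -> 1 \in s ->
  count_mem 1 (up s) < count_mem 1 s.
Proof.
move=> n1 ps h; have [_ h1 _ pe _] := up_part n1 ps h.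
case: s {h n1} h1 ps pe => //= a s h1 ps /seq.permP/(_ (pred1 1)) /= <-.
by rewrite (_ : (a.+1 == 1) = false); have := part_mem_pos ps (mem_head _ _); lia.
Qed.

(** * Counting chains by gap, and the numbers q_i *)

Definition tops n := [seq s <- parts n | 1 \notin s].

(** Appending a part 1 is a bijection from the partitions of n - 1 to the partitions of n that
    contain 1. *)
Lemma size_tops n : 0 < n -> size (tops n) = npart n - npart n.-1.
Proof.
move=> n0; rewrite -!size_parts size_filter.
suff -> : size (parts n.-1) = count (fun s => 1 \in s) (parts n).
  by rewrite -(count_predC (fun s => 1 \in s)) addKn; apply: eq_count.
rewrite -size_filter -(size_map (fun s => rcons s 1)).
apply/perm_size/uniq_perm.
- by rewrite map_inj_uniq ?parts_uniq // => s t /rcons_inj[].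
- by rewrite filter_uniq // parts_uniq.
move=> s; rewrite mem_filter mem_parts; apply/mapP/andP => [[t]|[h ps]].
  rewrite mem_parts => pt ->; rewrite mem_rcons mem_head; split=> //.
  apply/and3P; split.
  - by apply: sorted_rcons1; [apply: is_part_sorted pt|apply: is_part_pos pt].
  - by rewrite all_rcons (is_part_pos pt).
  - by rewrite sumn_rcons (is_part_sum pt); lia.
have es := part_ones ps; case E: (count_mem 1 s) es => [|k].
  by move/count_memPn: E; rewrite h.
rewrite -[k.+1]addn1 nseqD catA cats1 => es.
exists ([seq x <- s | 1 < x] ++ nseq k 1) => //.
rewrite mem_parts; apply/and3P; split.
- by have := is_part_sorted ps; rewrite {1}es -cats1 => /(cat_sorted2)[].
- by have := is_part_pos ps; rewrite {1}es all_rcons => /andP[].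
- by have := is_part_sum ps; rewrite {1}es sumn_rcons => <-; rewrite addn1.
Qed.

(** Adding n - j to the largest part is a bijection from the partitions of j without part 1 to those
    counted here. *)
Lemma count_tops_gap n j : 1 < j <= n ->
  count (fun s => n - j <= gap s) (tops n) = npart j - npart j.-1.
Proof.
move=> /andP[j1 jn]; rewrite -size_tops; last lia.
pose f s := if s is a :: s' then a + (n - j) :: s' else [::].
rewrite -size_filter -(size_map f (tops j)).
have tops_pos k s : 1 < k -> s \in tops k -> exists a t, s = a :: t.
  move=> k1; rewrite mem_filter mem_parts; case: s => [|a t _]; last by exists a, t.
  by case/andP=> _ /is_part_sum /=; lia.
apply/esym/perm_size/uniq_perm.
- rewrite map_inj_in_uniq ?filter_uniq ?parts_uniq // => s t hs ht.
  have [a [s' ->]] := tops_pos j s j1 hs.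
  have [b [t' ->]] := tops_pos j t j1 ht.
  by move=> [/eqP]; rewrite eqn_add2r => /eqP -> ->.
- by rewrite !filter_uniq // parts_uniq.
move=> s; rewrite mem_filter; apply/mapP/andP => [[t ht ->]|[hg hs]].
  have [a [t' et]] := tops_pos j t j1 ht; subst t.
  move: ht; rewrite !mem_filter !mem_parts => /andP[h1 pt].
  have := part_gt1 pt h1; move: (pt); rewrite /= !is_part_cons !inE !negb_or.
  move=> /and4P[a0 aj sa pt'] /andP[a2 _]; rewrite inE negb_or in h1.
  have /andP[_ h1'] := h1.
  split; last first.
    rewrite (_ : n - (a + (n - j)) = j - a) ?pt'; last lia.
    rewrite h1' !andbT; apply/and4P; split; try lia.
    by apply: sub_all sa => x /=; lia.
  rewrite /gap /=; case: t' sa {pt pt' h1 h1'} => [|b t'] /=; first lia.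
  by move/andP=> [/= ab _]; lia.
have n1 : 1 < n by lia.
have [a [t es]] := tops_pos n s n1 hs; subst s.
exists (a - (n - j) :: t); last first.
  by rewrite /= subnK //; move: hg; rewrite /gap /=; lia.
move: hs; rewrite !mem_filter !mem_parts => /andP[h1 pt].
have := part_gt1 pt h1 => /= /andP[a2 t2].
have := pt; rewrite !is_part_cons => /and4P[a0 an ta pt'].
move: h1; rewrite !inE !negb_or => /andP[_ ->]; rewrite andbT.
rewrite /gap /= in hg.
have ht x : x \in t -> x <= a - (n - j).
  by move/(part_head0_leq pt); case: t hg ta {pt t2 pt'} => [|b t] //= hg; [lia|case/andP => /=; lia].
(* The shortened first part equals j when it is alone and is otherwise at least the second part. *)
have ag : 1 < a - (n - j).
  case: t hg pt pt' t2 ht ta => [|b t] hg pt pt' t2 ht ta.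
    by have := is_part_sum pt => /=; lia.
  by have := ht b (mem_head _ _); move: t2 => /= /andP[]; lia.
rewrite (_ : j - (a - (n - j)) = n - a) ?pt'; last lia.
rewrite andbT; apply/and4P; split; try lia.
by apply/allP => x /ht.
Qed.

Lemma leq_nth_sorted u k i : sorted geq u -> i < size u ->
  (k <= nth 0 u i) = (i < count (leq k) u).
Proof.
elim: u i => //= a u IH i; rewrite path_sortedE; last exact: geq_trans.
case/andP=> au su; case: i => [|i] iu /=.
  case: (leqP k a) => ka; first lia.
  rewrite add0n; apply/esym/negbTE; rewrite -leqNgt leqn0 -leqn0 leqNgt -has_count.
  by apply/hasPn => x /(allP au) /=; lia.
rewrite IH //; case: (leqP k a) => ka; first lia.
rewrite add0n; have -> : count (leq k) u = 0.
  by apply/eqP; rewrite -leqn0 leqNgt -has_count; apply/hasPn => x /(allP au) /=; lia.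
by rewrite !ltn0.
Qed.

Lemma prod_ffact n g : g < n -> \prod_(1 <= j < n.+1 | n - j <= g) j = n ^_ g.+1.
Proof.
move=> gn; rewrite (big_cat_nat (n := n - g)) /=; [|lia|lia].
rewrite big_nat_cond big_pred0 ?mul1n; last by move=> j; apply/negP; lia.
rewrite big_nat_cond (eq_bigl (fun j => (n - g <= j < n.+1))); last by move=> j; lia.
rewrite -big_nat; apply/eqP; rewrite -(eqn_pmul2r (fact_gt0 (n - g.+1))).
rewrite ffact_fact // fact_prod mulnC (_ : (n - g.+1).+1 = n - g); last lia.
rewrite fact_prod [X in _ == X](big_cat_nat (n := n - g)) //=; lia.
Qed.

(** Decreasing gap is the order that gives the chain at position i, counted from 0, the modulus
    q_(i+2). *)
Definition rtops n :=
  sort (relpre gap geq) [seq s <- tops n | s != [:: n]].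

Lemma mem_tops n s : (s \in tops n) = (1 \notin s) && is_part n s.
Proof. by rewrite mem_filter mem_parts. Qed.

Lemma row_tops n : 1 < n -> [:: n] \in tops n.
Proof. by move=> n1; rewrite mem_tops inE /is_part /=; lia. Qed.

Lemma mem_rtops n s : (s \in rtops n) = (s != [:: n]) && (s \in tops n).
Proof. by rewrite mem_sort mem_filter. Qed.

Lemma rtops_uniq n : uniq (rtops n).
Proof. by rewrite sort_uniq !filter_uniq // parts_uniq. Qed.

Lemma perm_tops n : 1 < n -> perm_eq (tops n) ([:: n] :: rtops n).
Proof.
move=> n1; apply: uniq_perm.
- by rewrite filter_uniq // parts_uniq.
- by rewrite /= rtops_uniq mem_rtops eqxx.
by move=> s; rewrite inE mem_rtops; case: eqP => // ->; rewrite row_tops.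
Qed.

Lemma size_rtops n : 1 < n -> size (rtops n) = (npart n - npart n.-1).-1.
Proof. by move=> n1; rewrite -size_tops ?(perm_size (perm_tops n1)) //; lia. Qed.

Lemma npart01 : npart 1 - npart 0 = 0.
Proof.
rewrite -(@size_tops 1) //; case E: (tops 1) => [|s t] //.
have : s \in tops 1 by rewrite E mem_head.
rewrite mem_tops => /andP[h ps]; have := part_gt1 ps h.
case: s ps {E h} => [/is_part_sum //|a s /is_part_sum /= h /andP[]]; lia.
Qed.

(** Other than (n), a partition without part 1 has a second part, and it is at least 2. The strict
    bound makes the modulus nonzero. *)
Lemma rtops_gap n s : 1 < n -> s \in rtops n -> (gap s).+1 < n.
Proof.
move=> n1; rewrite mem_rtops mem_tops => /and3P[sn h ps]; have := part_gt1 ps h.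
have := is_part_sum ps; rewrite /gap; case: s sn {h ps} => [|a [|b s]] //=.
  by move=> hn e; move: hn; rewrite -e addn0 eqxx.
by move=> _ <- /and3P[]; lia.
Qed.

(** A factor j occurs when n - j is at most the i-th gap, that is, when more than i members of
    [rtops] have gap at least n - j. The partition (n), of gap n, always adds one to this count,
    whence the shift to i + 2. *)
Lemma modulus_rtops n i : 1 < n -> i < size (rtops n) ->
  modulus n (nth [::] (rtops n) i) = qfac n i.+2.
Proof.
move=> n1 hi; set s := nth _ _ _.
have sr : s \in rtops n by apply: mem_nth.
have gs := rtops_gap n1 sr.
rewrite /modulus; move: (sr); rewrite mem_rtops => /andP[/negbTE -> _].
rewrite -prod_ffact; last lia.
rewrite /qfac big_nat_cond [RHS]big_nat_cond; apply: eq_bigl => j.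
case: (boolP (1 <= j < n.+1)) => //= /andP[j0 jn].
(* The factor 1 is absent on both sides: p(1) - p(0) = 0, and n - 1 exceeds the gap. *)
have [j1|j1] := leqP j 1.
  have -> : j = 1 by lia.
  by rewrite npart01; lia.
have jn' : 1 < j <= n by lia.
rewrite -(count_tops_gap jn') (seq.permP (perm_tops n1)) /= {1}/gap /=.
rewrite (_ : (n - j <= n - 0) = true); last lia.
rewrite add1n ltnS.
have := @leq_nth_sorted (map gap (rtops n)) (n - j) i.
rewrite size_map (nth_map [::]) // count_map => -> //.
rewrite sorted_map; apply: sort_sorted => a b /=; lia.
Qed.

(** * Bases adapted to the chains *)

Definition norm_part (s : seq nat) := sort geq [seq x <- s | 0 < x].

Lemma norm_part_part n s : sumn s = n -> is_part n (norm_part s).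
Proof.
by move=> sn; apply: is_part_sort; rewrite ?sumn_filter_pos // filter_all.
Qed.

Lemma count_norm_part x s : 0 < x -> count_mem x (norm_part s) = count_mem x s.
Proof.
by move=> x0; rewrite count_sort count_filter; apply: eq_count => y /=; lia.
Qed.

Lemma mem_norm_part x s : 0 < x -> (x \in norm_part s) = (x \in s).
Proof. by move=> x0; rewrite mem_sort mem_filter x0. Qed.

Lemma part_leq_head n s x : is_part n s -> x \in s -> x <= head 0 s.
Proof.
case: s => // a s ps; rewrite inE => /orP[/eqP->//|]; exact: part_head_leq ps.
Qed.

Lemma leq_nth_sumn s i : nth 0 s i <= sumn s.
Proof.
elim: s i => [|a s IH] [|i] //=; first exact: leq_addr.
exact: leq_trans (IH i) (leq_addl _ _).
Qed.

Lemma norm_part_eq n s t : is_part n s -> perm_eq [seq x <- t | 0 < x] s ->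
  norm_part t = s.
Proof.
move=> ps pe; have e : sumn t = n.
  by rewrite -(is_part_sum ps) -(perm_sumn pe) sumn_filter_pos.
by apply: (part_eq (norm_part_part e) ps); rewrite perm_sort.
Qed.

Lemma fin_choice (T : eqType) (V : Type) (R : T -> V -> Prop) (v0 : V) (l : seq T) :
  (forall s, s \in l -> exists v, R s v) ->
  exists f : T -> V, forall s, s \in l -> R s (f s).
Proof.
elim: l => [|a l IH] H; first by exists (fun=> v0).
have [v Hv] := H a (mem_head _ _).
have [|f Hf] := IH; first by move=> s sl; apply: H; rewrite inE sl orbT.
exists (fun s => if s == a then v else f s) => s; rewrite inE.
by case: eqP => [->//|_] /= /Hf.
Qed.

(** * Triangular solution of (X - k) p = q *)

Section Chains.

Local Open Scope ring_scope.

Variables (n : nat) (V : zmodType) (X : {additive V -> V}) (h : seq nat -> V).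
Hypothesis n1 : (1 < n)%N.
Hypothesis HX : forall s, is_part n s ->
  X (h s) = \sum_(i < size s) h (norm_part (1%N :: set_nth 0%N s i (nth 0%N s i).-1)).

Inductive span (P : pred (seq nat)) : V -> Prop :=
| span0 : span P 0
| spanB u v : span P u -> span P v -> span P (u - v)
| span_gen s : is_part n s -> P s -> span P (h s).

Lemma spanN P u : span P u -> span P (- u).
Proof. by move=> pu; rewrite -[- u]add0r; apply: spanB => //; apply: span0. Qed.

Lemma spanD P u v : span P u -> span P v -> span P (u + v).
Proof. by move=> pu /spanN pv; rewrite -[v]opprK; apply: spanB. Qed.

Lemma spanMn P u k : span P u -> span P (u *+ k).
Proof.
by move=> pu; elim: k => [|k IH]; rewrite ?mulr0n ?mulrS; [apply: span0|apply: spanD].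
Qed.

Lemma span_sum P I (r : seq I) (Q : pred I) F :
  (forall i, Q i -> span P (F i)) -> span P (\sum_(i <- r | Q i) F i).
Proof. by move=> H; apply: big_ind => //; [apply: span0|apply: spanD]. Qed.

Lemma span_mono (P Q : pred (seq nat)) u :
  (forall s, is_part n s -> P s -> Q s) -> span P u -> span Q u.
Proof.
move=> PQ; elim=> [|? ? _ ? _ ?|s ps /(PQ _ ps) qs]; first exact: span0.
  exact: spanB.
exact: span_gen.
Qed.

(** Lowering a part 1 and adding a 1 gives the same partition back, so these terms absorb the k
    subtracted copies. Lowering another tail part keeps b and gains a 1. Only lowering b itself
    gives the main term. *)
Lemma X_cons b s k : is_part n (b :: s) -> (1 < b)%N ->
    (k <= count_mem 1%N (b :: s))%N ->
  exists2 r, span (fun t => (k < count_mem 1%N t)%N && (b <= head 0%N t)%N) r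
  & X (h (b :: s)) - h (b :: s) *+ k = h (norm_part [:: 1%N, b.-1 & s]) + r.
Proof.
move=> ps b1 kc.
have bF : (b == 1)%N = false by lia.
rewrite HX // big_ord_recl /=.
pose T (i : 'I_(size s)) :=
  norm_part [:: 1%N, b & set_nth 0%N s i (nth 0%N s i).-1].
exists (\sum_(i < size s) h (T i) - h (b :: s) *+ k); last by rewrite addrA.
have := kc; rewrite /= bF add0n => kc'.
have -> : \sum_(i < size s) h (T i) - h (b :: s) *+ k =
   \sum_(i < size s | nth 0%N s i != 1%N) h (T i)
   + h (b :: s) *+ (count_mem 1%N s - k).
  rewrite (bigID (fun i : 'I__ => nth 0%N s i == 1%N)) /=.
  rewrite [Z in Z + _ - _](eq_bigr (fun=> h (b :: s))); last first.
    move=> i /eqP si; congr h; apply: (norm_part_eq ps).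
    rewrite si /= (_ : 0 < b)%N; last lia.
    have sp : all (leq 1) s by have /= /andP[] := is_part_pos ps.
    rewrite (perm_catCA [:: 1%N] [:: b]) perm_cons /=.
    apply/seq.permP => p; rewrite /= count_filter.
    rewrite count_set_nth_ltn ?ltn_ord // si /= andbF andbT addn0.
    have -> : count (predI p (leq 1)) s = count p s.
      by apply: eq_in_count => x /(allP sp) /= ->; rewrite andbT.
    have : (0 < count_mem 1%N s)%N.
      by rewrite -has_count has_pred1 -si mem_nth.
    case p1 : (p 1%N) => /=; last by rewrite subn0 add0n.
    have : (count_mem 1%N s <= count p s)%N.
      by apply: sub_count => x /= /eqP ->.
    by move=> c1 c0; rewrite addnC subnK //; apply: leq_trans c1.
  rewrite (_ : \sum_(i < size s | _) h (b :: s) = h (b :: s) *+ count_mem 1%N s).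
    by rewrite mulrnBr // addrAC addrC addrA.
  by rewrite -(big_mkord (fun i => nth 0%N s i == 1%N) (fun=> h (b :: s)))
     -(big_nth 0%N (fun x => x == 1%N) (fun=> h (b :: s))) big_const_seq iter_addr_0.
have si0 (i : 'I_(size s)) : (0 < nth 0%N s i)%N.
  by apply: (part_mem_pos ps); rewrite inE mem_nth ?orbT.
have pT (i : 'I_(size s)) : is_part n (T i).
  apply: norm_part_part; rewrite /= sumn_set_nth_ltn //.
  have := is_part_sum ps => /=.
  have := si0 i.
  have := leq_nth_sumn s i.
  lia.
apply: spanD.
  apply: span_sum => i si1; apply: span_gen => //.
  apply/andP; split.
    rewrite count_norm_part //= bF add0n count_set_nth_ltn //=.
    by rewrite (negbTE si1) subn0; lia.
  by apply: (part_leq_head (pT i)); rewrite mem_norm_part ?inE ?eqxx ?orbT //; lia.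
have [kc2|] := ltnP k (count_mem 1%N s); last by rewrite -subn_eq0 => /eqP ->; rewrite mulr0n; apply: span0.
by apply: spanMn; apply: span_gen => //=; rewrite bF add0n kc2 /=.
Qed.

Definition lifts k (a : nat) q := exists2 p,
  span (fun t => (k <= count_mem 1%N t)%N && (a < head 0%N t)%N) p & X p - p *+ k = q.

Lemma lift_span k a q (P : pred (seq nat)) :
  (forall s, is_part n s -> P s -> lifts k a (h s)) -> span P q -> lifts k a q.
Proof.
move=> H; elim=> [|u v _ [p sp <-] _ [p' sp' <-]|s ps Ps].
- by exists 0; [apply: span0|rewrite raddf0 mul0rn subr0].
- exists (p - p'); first exact: spanB.
  by rewrite raddfB mulrnBl !opprB addrACA [RHS]addrACA [- X p' + _]addrC.
- exact: H.
Qed.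

(** Applying X - k to h at [up s] gives h s plus terms of larger first part, which lift by
    induction. The bound on k serves the all-ones partition, where [up] drops m_1 from n to n -
    2. *)
Lemma lift_part k s : (k <= n - 2)%N -> is_part n s -> (k < count_mem 1%N s)%N ->
  lifts k (head 0%N s) (h s).
Proof.
move=> k2; have [d] := ubnP (n - head 0%N s); elim: d s => // d IH s hd ps ks.
have s1 : 1%N \in s by rewrite -has_pred1 has_count; lia.
have [pu h1 du pe nu] := up_part n1 ps s1.
case: s => // a s in hd ps ks s1 pu h1 du pe nu *.
have ku : (k <= count_mem 1%N (up (a :: s)))%N.
  have /= e := seq.permP pe (pred1 1%N).
  have := part_all_ones ps; have := ps; rewrite is_part_cons => /and4P[a0 an sa ps'].
  rewrite /= (_ : a.+1 == 1 = false)%N; last lia.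
  case: (ltngtP a 1) => [|a1|a1]; first by rewrite ltnNge a0.
    by move: ks; rewrite /= -e (_ : (a == 1)%N = false) // gtn_eqF.
  have es : s = nseq (n - 1) 1.
    by rewrite -a1; apply: part_all_ones ps' _; rewrite -a1.
  by move: e; rewrite es count_ones add0n; clear - k2; lia.
have a1 : (1 < a.+1)%N by rewrite ltnS; apply: (part_mem_pos ps (mem_head _ _)).
have [r sr er] := X_cons pu a1 ku.
have Hs (t : seq nat) : is_part n t -> (k < count_mem 1 t)%N && (a.+1 <= head 0 t)%N ->
    lifts k a.+1 (h t).
  move=> pt /andP[kt ht]; have [] := IH t _ pt kt.
      have an : (a.+1 <= n)%N := part_nth_leq 0 pu.
      by rewrite /= in hd; clear - hd an ht; lia.
    move=> p sp ep; exists p => //; apply: span_mono sp => u _ /andP[-> /=].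
    by apply: leq_trans.
have eh : norm_part [:: 1%N, a.+1.-1 & rem 1%N s] = a :: s.
  apply: (norm_part_eq ps).
  have /all_filterP -> : all (fun x => 0 < x)%N [:: 1%N, a & rem 1%N s].
    have /= sp := is_part_pos pu.
    by rewrite /= (part_mem_pos ps (mem_head _ _)).
  by rewrite (perm_catCA [:: 1%N] [:: a]) perm_cons.
rewrite eh in er.
have Xu : h (a :: s) = (X (h (a.+1 :: rem 1%N s)) - h (a.+1 :: rem 1%N s) *+ k) - r.
  by rewrite er addrK.
have [p sp ep] := lift_span Hs sr.
exists (h (a.+1 :: rem 1%N s) - p); last by rewrite Xu -ep raddfB mulrnBl !opprB addrACA [RHS]addrACA [- X p + _]addrC.
apply: spanB.
  by apply: span_gen => //=; rewrite ku /=.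
by apply: span_mono sp => t _ /andP[-> /=]; apply: ltn_trans.
Qed.

Lemma X_ones : X (h (nseq n 1%N)) = h (nseq n 1%N) *+ n.
Proof.
have po : is_part n (nseq n 1%N).
  apply/and3P; split; last by rewrite sumn_nseq mul1n.
    by elim: (n) => //= -[|k].
  by apply/allP => x /nseqP[->].
rewrite HX // size_nseq (eq_bigr (fun=> h (nseq n 1%N))) => [|i _].
  by rewrite sumr_const card_ord.
congr h; apply: (norm_part_eq po); rewrite nth_nseq ltn_ord /=.
have {2}-> : nseq n 1%N = 1%N :: nseq n.-1 1%N by case: (n) n1.
rewrite perm_cons; apply/seq.permP => p.
rewrite count_filter count_set_nth_ltn ?size_nseq //.
rewrite nth_nseq ltn_ord !count_nseq /=; lia.
Qed.

(** The error g s - h s has larger first parts, which makes g unitriangular over h, and no fewer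
    parts 1, which lets later errors be lifted. *)
Definition chain_spec (g : seq nat -> V) s :=
  span (fun t => (count_mem 1 s <= count_mem 1 t) && (head 0 s < head 0 t))%N (g s - h s)
  /\ X (g s) - g s *+ count_mem 1%N s = if desc s then g (nxt s) else 0.

Lemma count_nxt a s : (1 < a)%N ->
  (count_mem 1%N (a :: s) < count_mem 1%N (nxt (a :: s)))%N.
Proof. by move=> a1 /=; rewrite -cats1 count_cat /=; lia. Qed.

Lemma span_leq_lift k a q : (k <= n - 2)%N ->
  span (fun t => (k < count_mem 1 t) && (a <= head 0 t))%N q -> lifts k a q.
Proof.
move=> k2; apply: lift_span => s ps /andP[ks hs].
have [p sp ep] := lift_part k2 ps ks; exists p => //.
by apply: span_mono sp => t _ /andP[-> /=]; apply: leq_ltn_trans.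
Qed.

(** Recursion on the largest part: that of [nxt s] is smaller, so g (nxt s) is known. The difference
    between (X - m_1) (h s) and g (nxt s) has more parts 1 than s and first parts no smaller;
    subtracting its lift from h s gives g s. *)
Lemma chain_exists : exists g, forall s, is_part n s -> chain_spec g s.
Proof.
suff /(_ n)[g Hg] d : exists g, forall s, is_part n s -> (head 0 s <= d)%N -> chain_spec g s.
  by exists g => s ps; apply: Hg => //; rewrite -nth0 (part_nth_leq _ ps).
elim: d => [|d [g Hg]].
  exists (fun=> 0) => -[|a s] ps; first by move/is_part_sum: ps => /= e; move: n1; rewrite -e.
  move=> /=; rewrite leqn0 => /eqP e.
  by have := part_mem_pos ps (mem_head _ _); rewrite e.
pose R s v := span (fun t => (count_mem 1 s <= count_mem 1 t) && (head 0 s < head 0 t))%N (v - h s)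
  /\ X v - v *+ count_mem 1%N s = if desc s then g (nxt s) else 0.
have [|f Hf] := @fin_choice _ V R 0 [seq s <- parts n | head 0 s == d.+1]; last first.
  exists (fun s => if (head 0 s <= d)%N then g s else f s) => s ps hs.
  have e : desc s -> (head 0 (nxt s) <= d)%N.
    by case: s hs {ps} => //= a s ha /andP[a1 _]; clear - a1 ha; lia.
  have e' : (if desc s then if (head 0 (nxt s) <= d)%N then g (nxt s) else f (nxt s) else 0)
     = if desc s then g (nxt s) else 0 by case: (desc s) e => // ->.
  rewrite /chain_spec e'; case: ifP => hd; first exact: Hg.
  by apply: Hf; rewrite mem_filter mem_parts ps andbT eqn_leq hs ltnNge hd.
move=> s; rewrite mem_filter mem_parts => /andP[/eqP hs ps].
case: s => [|a s] //= in hs ps *; subst a.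
(* With first part 1, s is all ones and h s is an eigenvector of eigenvalue n = m_1, so no
   correction is made. *)
have [d1|d1] := ltnP 1 d.+1; last first.
  have d0 : d = 0%N by lia.
  have es : 1%N :: s = nseq n 1%N.
    apply: part_all_ones; first by rewrite d0 in ps.
    by move: ps; rewrite d0 is_part_cons => /and4P[_ _].
  exists (h (nseq n 1%N)); rewrite /R d0 es; split; first by rewrite subrr; apply: span0.
  rewrite count_ones X_ones subrr.
  by rewrite -es.
set k := count_mem 1%N (d.+1 :: s).
have k2 : (k <= n - 2)%N.
  have sd : (d.+1 + sumn s = n)%N := is_part_sum ps.
  have cs : (count_mem 1%N s <= sumn s)%N.
    elim: (s) => //= b t IH; apply: leq_add IH; by case: b => [|[|b]].
  by rewrite /k /= (gtn_eqF d1) -sd add0n; apply: leq_trans cs _; clear - d1; lia.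
have [r sr er] := X_cons ps d1 (leqnn k).
have [q sq eq] : exists2 q, span (fun t => (k < count_mem 1 t) && (d.+1 <= head 0 t))%N q
  & h (norm_part [:: 1%N, d.+1.-1 & s]) + r = (if desc (d.+1 :: s) then g (nxt (d.+1 :: s)) else 0) + q.
  have pn : is_part n (norm_part [:: 1%N, d.+1.-1 & s]).
    by apply: norm_part_part; have := is_part_sum ps => /=; lia.
  case: ifP => ds.
    have en : norm_part [:: 1%N, d.+1.-1 & s] = nxt (d.+1 :: s).
      apply: norm_part_eq; first exact: nxt_part ps ds.
      have /all_filterP -> : all (fun x => 0 < x)%N [:: 1%N, d.+1.-1 & s].
        by have /= sp := is_part_pos ps; rewrite /= sp andbT; lia.
      rewrite (perm_catCA [:: 1%N] [:: d]) /= perm_cons perm_sym perm_rcons.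
      exact: perm_refl.
    have [] := Hg _ (nxt_part ps ds); first by rewrite /=.
    rewrite en => sg _.
    exists (r - (g (nxt (d.+1 :: s)) - h (nxt (d.+1 :: s)))).
      apply: spanB sr _; apply: span_mono sg => t _ /andP[ct ht].
      by rewrite (leq_trans (count_nxt s d1) ct) /=.
    by rewrite opprB (addrC r) addrA (addrC (g _)) subrK.
  (* The chain stops at s because its first part is repeated; a copy survives the lowering, so the
     main term joins the error. *)
  exists (h (norm_part [:: 1%N, d.+1.-1 & s]) + r); last by rewrite add0r.
  apply: spanD sr; apply: span_gen => //; apply/andP; split.
    by rewrite count_norm_part // /k /=; lia.
  case: s ps ds {k k2 er} pn => [|b s] ps ds pn.
    by rewrite /= in ds; lia.
  apply: (part_leq_head pn); rewrite mem_norm_part // !inE.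
  have := part_head_leq ps (mem_head _ _); have /= := ds; lia.
have [p sp ep] := span_leq_lift k2 sq.
exists (h (d.+1 :: s) - p); split.
  by rewrite addrC addKr; apply: spanN.
rewrite -/k raddfB mulrnBl opprB addrACA [- X p + _]addrC addrACA
  -[p *+ k - X p]opprB ep er eq.
by rewrite addrK.
Qed.

End Chains.

(** * The cokernel of a chain operator *)

Section Cokernel.

Local Open Scope ring_scope.

Variables (n : nat) (V : zmodType) (A : {additive V -> V}) (g : seq nat -> V).
Variables (y : seq nat -> {additive V -> int}) (deg : {additive V -> int}).
Hypothesis n1 : (1 < n)%N.
Hypothesis Ag : forall s, is_part n s ->
  A (g s) = g s *+ (n - count_mem 1%N s) - (if desc s then g (nxt s) else 0).
Hypothesis gy : forall v, v = \sum_(s <- parts n) g s *~ y s v.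
Hypothesis yg : forall s t, is_part n s -> is_part n t -> y s (g t) = (s == t)%:R.
Hypothesis degA : forall v, deg (A v) = 0.
Hypothesis deg_neq0 : exists v, deg v != 0.

Definition imA u := exists z, u = A z.

Lemma imA0 : imA 0.
Proof. by exists 0; rewrite raddf0. Qed.

Lemma imAB u v : imA u -> imA v -> imA (u - v).
Proof. by move=> [z ->] [z' ->]; exists (z - z'); rewrite raddfB. Qed.

Lemma imAD u v : imA u -> imA v -> imA (u + v).
Proof. by move=> [z ->] [z' ->]; exists (z + z'); rewrite raddfD. Qed.

Lemma imAMz u c : imA u -> imA (u *~ c).
Proof. by move=> [z ->]; exists (z *~ c); rewrite raddfMz. Qed.

(** In the cokernel the relation at [up s] reads g s = (n - m_1) g (up s), with m_1 that of [up s];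
    induct on the number of parts 1. *)
Lemma g_congr_top s : is_part n s -> imA (g s - g (top s) *+ weight n s).
Proof.
have [d] := ubnP (count_mem 1%N s); elim: d s => // d IH s sd ps.
have [s1|s1] := boolP (1%N \in s); last first.
  by rewrite (weight_id _ s1) (top_id _ ps s1) ?subrr; [apply: imA0|lia].
have [pu _ du _ nu] := up_part n1 ps s1.
have cu := count_up n1 ps s1.
have -> : top s = top (up s) by rewrite -{1}nu (top_nxt pu du).
have -> : weight n s = ((n - count_mem 1%N (up s)) * weight n (up s))%N.
  by rewrite -{1}nu (weight_nxt pu du).
have := Ag pu; rewrite du nu => Ae.
have -> : g s - g (top (up s)) *+ ((n - count_mem 1%N (up s)) * weight n (up s)) =
   (g (up s) - g (top (up s)) *+ weight n (up s)) *~ (n - count_mem 1%N (up s))%N%:Z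
   - A (g (up s)).
  by rewrite Ae -pmulrn mulrnBl -mulrnA mulnC opprB [RHS]addrC addrA subrK.
apply: imAB; last by exists (g (up s)).
by apply/imAMz/IH => //; lia.
Qed.

Lemma bottom_exists s : is_part n s ->
  exists b, [/\ is_part n b, ~~ desc b & top b = top s].
Proof.
have [d] := ubnP (head 0%N s); elim: d s => // d IH s sd ps.
have [ds|ds] := boolP (desc s); last by exists s.
have [||b [pb db tb]] := IH (nxt s); last by exists b; rewrite tb (top_nxt ps ds).
  by case: s sd ds {ps} => //= a s sd /andP[a1 _]; clear - sd a1; lia.
exact: nxt_part.
Qed.

(** At the last partition b of the chain the relation is (n - m_1(b)) g b = 0 in the cokernel, and g
    b is there [weight n b] times g s. *)
Lemma g_torsion s : s \in tops n -> imA (g s *+ modulus n s).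
Proof.
rewrite mem_tops => /andP[s1 ps]; have [b [pb db tb]] := bottom_exists ps.
have ts : top s = s by apply: top_id ps s1; lia.
rewrite -{2}ts -tb modulus_bottom //.
have := Ag pb; rewrite (negbTE db) subr0 => Ae.
have -> : g s *+ ((n - count_mem 1%N b) * weight n b) =
   A (g b) - (g b - g (top b) *+ weight n b) *~ (n - count_mem 1%N b)%N%:Z.
  by rewrite Ae -pmulrn mulrnBl -mulrnA mulnC tb ts opprB addrC subrK.
by apply: imAB; [exists (g b)|apply/imAMz/g_congr_top].
Qed.

(** A nonzero multiple of g s lies in the image, where [deg] vanishes, and the integers are torsion
    free. *)
Lemma deg_rtops s : s \in rtops n -> deg (g s) = 0.
Proof.
move=> sr; have := rtops_gap n1 sr; have := sr; rewrite mem_rtops => /andP[sn st] gs.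
have [z ez] := g_torsion st.
have := degA z; rewrite -ez raddfMn /= /modulus (negbTE sn) => /eqP.
rewrite mulrn_eq0 => /orP[|/eqP //].
by rewrite -leqn0 leqNgt ffact_gt0; move: gs; clear; lia.
Qed.

(** The coefficient of g s after each g t is replaced, modulo the image, by its multiple of g (top
    t). *)
Definition phi s v : int := \sum_(t <- parts n | top t == s) y t v * (weight n t)%:R.

Lemma phi_is_additive s : additive (phi s).
Proof.
move=> u v; rewrite /phi -sumrB; apply: eq_bigr => t _.
by rewrite raddfB mulrBl.
Qed.
HB.instance Definition _ s := GRing.isAdditive.Build V int (phi s) (phi_is_additive s).

Lemma phi_g s t : is_part n t -> phi s (g t) = (top t == s)%:R * (weight n t)%:R.
Proof.
move=> pt; rewrite /phi big_mkcond (bigD1_seq t) ?mem_parts ?parts_uniq //=.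
rewrite yg // eqxx mul1r big_seq_cond big1 ?addr0.
  by case: eqP; rewrite ?mul1r ?mul0r.
move=> u /andP[]; rewrite mem_parts => pu ut.
by rewrite yg // (negbTE ut) mul0r; case: ifP.
Qed.

(** On a basis vector g t the two terms of A (g t) cancel by the recursion for [weight], unless t
    ends the chain of s, where the modulus appears. *)
Lemma phi_A s v : ((modulus n s)%:Z %| phi s (A v))%Z.
Proof.
rewrite [v]gy raddf_sum raddf_sum big_seq; apply: rpred_sum => t; rewrite mem_parts => pt.
rewrite !raddfMz /= -mulrzr; apply: dvdz_mulr.
rewrite Ag // raddfB raddfMn /= phi_g //.
have [dt|dt] := boolP (desc t).
  rewrite phi_g ?nxt_part // (top_nxt pt dt) (weight_nxt pt dt) natrM.
  by rewrite -[Z in Z - _]mulr_natl [Z in _ - Z]mulrCA subrr dvdz0.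
rewrite raddf0 subr0; case: eqP => [<-|_]; last by rewrite mul0r mul0rn dvdz0.
by rewrite mul1r modulus_bottom // -(mulr_natl (weight n t)%:R) -natrM natz dvdzz.
Qed.

Lemma phi_tops s t : s \in tops n -> phi t (g s) = (s == t)%:R.
Proof.
rewrite mem_tops => /andP[s1 ps].
by rewrite phi_g // (weight_id _ s1) mulr1 (top_id _ ps s1) //; lia.
Qed.

Lemma tops_rtops s : s \in rtops n -> s \in tops n.
Proof. by rewrite mem_rtops => /andP[]. Qed.

Lemma phi_rtops c s : s \in rtops n -> phi s (\sum_(t <- rtops n) g t *~ c t) = c s.
Proof.
move=> sr; rewrite raddf_sum (bigD1_seq s) ?rtops_uniq //= big_seq_cond big1 => [|t].
  by rewrite addr0 raddfMz /= phi_tops ?tops_rtops // eqxx intz.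
case/andP=> tr /negbTE ts.
by rewrite raddfMz /= phi_tops ?tops_rtops // ts mul0rz.
Qed.

Lemma deg_sum_rtops c : deg (\sum_(t <- rtops n) g t *~ c t) = 0.
Proof.
rewrite raddf_sum big_seq big1 // => t tr.
by rewrite raddfMz /= deg_rtops // mul0rz.
Qed.

Lemma congr_sum_tops v : imA (v - \sum_(s <- tops n) g s *~ phi s v).
Proof.
have -> : \sum_(s <- tops n) g s *~ phi s v =
    \sum_(t <- parts n) g (top t) *~ (y t v * (weight n t)%:R).
  rewrite /phi; under eq_bigr do rewrite mulrz_sumr big_mkcond.
  rewrite exchange_big /= [LHS]big_seq [RHS]big_seq; apply: eq_bigr => t.
  rewrite mem_parts => pt.
  rewrite (bigD1_seq (top t)) ?filter_uniq ?parts_uniq //=; last first.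
    by have [pu u1] := top_part n1 pt; rewrite mem_filter mem_parts u1.
  rewrite eqxx big1 ?addr0 // => s /negbTE.
  by rewrite eq_sym => ->.
rewrite {1}[v]gy -sumrB big_seq; apply: big_ind => [|u w|t]; first exact: imA0.
  exact: imAD.
rewrite mem_parts [y t v * _]mulrC => pt; have := imAMz (y t v) (g_congr_top pt).
by rewrite mulrzBl pmulrn -mulrzA natz.
Qed.

(** As [deg] kills the image and the g s of [rtops], it is a nonzero multiple of the coordinate at
    (n). Degree 0 thus removes the infinite summand, and divisibility settles the torsion ones. *)
Lemma imA_iff v :
  imA v <-> deg v = 0 /\ forall s, s \in rtops n -> ((modulus n s)%:Z %| phi s v)%Z.
Proof.
split=> [[z ->]|[dv Hv]]; first by rewrite degA; split=> // s _; apply: phi_A.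
have tsum u : \sum_(s <- tops n) g s *~ phi s u =
    g [:: n] *~ phi [:: n] u + \sum_(s <- rtops n) g s *~ phi s u.
  by rewrite (perm_big _ (perm_tops n1)) big_cons.
have degE u : deg u = deg (g [:: n]) *~ phi [:: n] u.
  have [z ez] := congr_sum_tops u.
  have := degA z; rewrite -ez raddfB /= tsum raddfD /= deg_sum_rtops addr0.
  by rewrite raddfMz /= => /eqP; rewrite subr_eq0 => /eqP.
have dg : deg (g [:: n]) != 0.
  by have [u] := deg_neq0; apply: contra => /eqP e; rewrite degE e mul0rz.
have p0 : phi [:: n] v = 0.
  by move/eqP: dv; rewrite degE -mulrzr intz mulf_eq0 (negbTE dg) => /eqP.
have := congr_sum_tops v; rewrite tsum p0 mulr0z add0r => Hc.
rewrite -[v](subrK (\sum_(s <- rtops n) g s *~ phi s v)); apply: imAD => //.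
rewrite big_seq; apply: big_ind => [|u w|s sr]; first exact: imA0.
  exact: imAD.
have /dvdzP[c ->] := Hv s sr; rewrite mulrC mulrzA -pmulrn.
by apply/imAMz/g_torsion/tops_rtops.
Qed.

End Cokernel.

(** * Conjugacy classes and cycle types *)

Section ConjugacyClasses.

Import GroupScope.

(** Serves to pair the cycles of two permutations by length; equally labelled elements are matched
    and removed one at a time. *)
Lemma perm_eq_map_match (A B C : eqType) (f : A -> C) (f' : B -> C) (b0 : B) (s : seq A) (t : seq B) :
  uniq s -> uniq t -> perm_eq (map f s) (map f' t) ->
  exists phi : A -> B, [/\ {in s, forall x, phi x \in t},
    {in s, forall x, f' (phi x) = f x} & {in s &, injective phi}].
Proof.
elim: s t => [|a s IH] t /=; first by exists (fun=> b0).
case/andP=> ais us ut pe.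
have /mapP[b bt eb] : f a \in map f' t by rewrite -(perm_mem pe) mem_head.
have pt := perm_to_rem bt.
have [||phi [h1 h2 h3]] := IH (rem b t) us; first exact: rem_uniq.
  by rewrite -(perm_cons (f a)) (perm_trans pe) // eb; exact: (perm_map f' pt).
have ub : b \notin rem b t by rewrite mem_rem_uniqF.
exists (fun x => if x == a then b else phi x); split.
- move=> x; rewrite inE; case: eqP => //= _ /h1; exact: mem_rem.
- by move=> x; rewrite inE; case: eqP => [->|_ /h2].
- move=> x x'; rewrite !inE; case: eqP => [->|_]; case: eqP => [->|_] //= xs xs'.
  + by move=> e; have := h1 _ xs'; rewrite -e (negbTE ub).
  + by move=> e; have := h1 _ xs; rewrite e (negbTE ub).
  + exact: h3.
Qed.

Section CycleType.

Variable T : finType.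
Implicit Types s t : {perm T}.

Lemma iter_porbit_inj s y a b : a < #|porbit s y| -> b < #|porbit s y| ->
  iter a s y = iter b s y -> a = b.
Proof.
move=> ha hb e; apply/eqP.
rewrite -(nth_uniq y _ _ (uniq_traject_porbit s y)) ?size_traject //.
by rewrite !nth_traject // e.
Qed.

Lemma porbit_iter s k x : porbit s (iter k s x) = porbit s x.
Proof. by rewrite -permX porbit_perm. Qed.

(** Pair the cycles by length, choose base points, and send the k-th iterate of s at a base point to
    the k-th iterate of t at the matching one. This map is injective and intertwines s and t. *)
Lemma same_cycle_type_conj s t :
  perm_eq [seq #|C| | C : {set T} <- enum (porbits s)]
          [seq #|C| | C : {set T} <- enum (porbits t)] ->
  exists u, t = s ^ u.
Proof.
move=> pe.
have [x0 _|T0] := pickP (xpredT : pred T); last first.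
  by exists 1; apply/permP => x; have := T0 x.
have [phi [phi_in phi_card phi_inj]] :=
  perm_eq_map_match set0 (enum_uniq _) (enum_uniq _) pe.
have reps r : exists f : {set T} -> T,
    forall C, C \in enum (porbits r) -> C = porbit r (f C).
  apply: (fin_choice (R := fun C x => C = porbit r x)) x0 _ _ => C; rewrite mem_enum => /imsetP[x _ ->].
  by exists x.
have [rs Hs] := reps s; have [rt Ht] := reps t.
have inS x : porbit s x \in enum (porbits s) by rewrite mem_enum imset_f.
pose y x := rs (porbit s x).
have py x : porbit s (y x) = porbit s x by rewrite -(Hs _ (inS x)).
pose z x := rt (phi (porbit s x)).
have pz x : porbit t (z x) = phi (porbit s x).
  by rewrite -(Ht _ (phi_in _ (inS x))).
have cz x : #|porbit t (z x)| = #|porbit s (y x)|.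
  by rewrite pz (phi_card _ (inS x)) py.
pose k x := index x (traject s (y x) #|porbit s (y x)|).
have kx x : x \in traject s (y x) #|porbit s (y x)|.
  by rewrite -porbit_traject py porbit_id.
have klt x : k x < #|porbit s (y x)|.
  by rewrite -[X in _ < X](size_traject s (y x)) index_mem.
have ek x : iter (k x) s (y x) = x.
  by rewrite -(nth_traject s (klt x)) nth_index.
pose u x := iter (k x) t (z x).
have pu x : porbit t (u x) = phi (porbit s x) by rewrite porbit_iter pz.
have u_inj : injective u.
  move=> x x' e; have ep : porbit s x = porbit s x'.
    by apply: phi_inj => //; rewrite -!pu e.
  have ey : y x = y x' by rewrite /y ep.
  have ez : z x = z x' by rewrite /z ep.
  have ekk : k x = k x'.
    apply: (@iter_porbit_inj t (z x)); rewrite ?cz ?klt ?ey ?klt //.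
    by rewrite {2}ez.
  by rewrite -(ek x) -(ek x') ekk ey.
have u_comm x : u (s x) = t (u x).
  have ep : porbit s (s x) = porbit s x by rewrite (porbit_iter s 1 x).
  have ey : y (s x) = y x by rewrite /y ep.
  have ez : z (s x) = z x by rewrite /z ep.
  rewrite /u ez -iterS.
  (* If x is the last point of its cycle, s x is the base point, of index 0. *)
  have := klt x; rewrite leq_eqVlt => /orP[/eqP e|h].
    rewrite e -(cz x) iter_porbit.
    suff -> : k (s x) = 0 by [].
    apply: (@iter_porbit_inj s (y x)).
    - by rewrite -ey klt.
    - by rewrite -e.
    - by rewrite -{1}ey ek -{1}(ek x) -iterS e iter_porbit.
  congr (iter _ t _); apply: (@iter_porbit_inj s (y x)) => //.
    by rewrite -ey klt.
  by rewrite -{1}ey ek iterS ek.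
exists (perm u_inj); apply/permP => x.
by rewrite -[x](permKV (perm u_inj)) permJ !permE u_comm.
Qed.

Lemma sum_card_porbits s : \sum_(C in porbits s) #|C| = #|T|.
Proof.
rewrite -cardsT; apply/esym/card_partition.
apply/and3P; split.
- apply/eqP/setP => x; rewrite inE; apply/bigcupP.
  by exists (porbit s x); rewrite ?imset_f ?porbit_id.
- apply/trivIsetP => A B /imsetP[x _ ->] /imsetP[x' _ ->].
  apply: contraR => /pred0Pn[z /andP[]] /=.
  by rewrite -!eq_porbit_mem => /eqP <- /eqP ->.
- apply/imsetP => -[x _ /setP/(_ x)]; by rewrite inE porbit_id.
Qed.

End CycleType.

Definition cycle_type n (s : 'S_n) : seq nat :=
  sort geq [seq #|C| | C : {set 'I_n} <- enum (porbits s)].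

Lemma cycle_type_part n (s : 'S_n) : is_part n (cycle_type s).
Proof.
apply: is_part_sort.
  apply/allP => c /mapP[C]; rewrite mem_enum => /imsetP[x _ ->] ->.
  by have := card_porbit_neq0 s x; lia.
by rewrite sumnE big_map big_enum /= sum_card_porbits card_ord.
Qed.

(** There are as many irreducible characters as classes, and the cycle type separates classes. *)
Lemma Nirr_leq_parts n : Nirr (Sn_group n) <= size (parts n).
Proof.
rewrite NirrE cardE -(size_map (fun C => cycle_type (repr C))).
apply: uniq_leq_size; last first.
  by move=> c /mapP[C _ ->]; rewrite mem_parts cycle_type_part.
rewrite map_inj_in_uniq ?enum_uniq // => C D.
rewrite !mem_enum => /repr_classesP[_ eC] /repr_classesP[_ eD] e.
have pc (r : 'S_n) :
    perm_eq (cycle_type r) [seq #|A| | A : {set 'I_n} <- enum (porbits r)].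
  by rewrite perm_sort.
have [|u eu] := @same_cycle_type_conj _ (repr C) (repr D).
  by apply: perm_trans (pc (repr D)); rewrite -e perm_sym.
by rewrite eC eD eu classGidl ?inE.
Qed.

End ConjugacyClasses.

(** * Young characters *)

Section PermutationCharacter.

Variables (gT : finGroupType) (G : {group gT}) (T : finType) (A : {set T}).
Variable f : gT -> T -> T.
Hypothesis f1 : forall x, f 1%g x = x.
Hypothesis fM : forall a b x, f (a * b)%g x = f b (f a x).
Hypothesis fA : forall a x, x \in A -> f a x \in A.

Definition action_mx (a : gT) : 'M[algC]_#|A| :=
  (\matrix_(i, j) (f a (enum_val i) == enum_val j)%:R)%R.

Lemma action_mx_repr : mx_repr G action_mx.
Proof.
split=> [|a b _ _]; apply/matrixP => i j; rewrite !mxE.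
  by rewrite f1 (inj_eq enum_val_inj).
have Ai := fA a (enum_valP i).
rewrite (bigD1 (enum_rank_in Ai (f a (enum_val i)))) //= !mxE enum_rankK_in //.
rewrite eqxx mul1r fM big1 ?addr0 // => k ki; rewrite !mxE.
case: eqP => [e|_]; last by rewrite mul0r.
by case/eqP: ki; apply: enum_val_inj; rewrite enum_rankK_in.
Qed.

Definition action_char : 'CF(G) := cfRepr (MxRepresentation action_mx_repr).

Lemma action_charE a : a \in G ->
  action_char a = (#|[set x in A | f a x == x]|%:R)%R.
Proof.
move=> Ga; rewrite cfunE Ga mulr1n /mxtrace.
under eq_bigr do rewrite mxE.
rewrite -(big_enum_val (fun x => (f a x == x)%:R : algC)%R) /=.
by rewrite -natr_sum -big_mkcondr sum1dep_card.
Qed.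

Lemma action_char_char : action_char \is a character.
Proof. exact: cfRepr_char. Qed.

End PermutationCharacter.

(** * Young characters from colourings, and the Pieri rule *)

Section Colorings.

Variable n : nat.
Local Notation coloring := {ffun 'I_n -> 'I_n.+1}.

Implicit Types w : coloring.

(** With n + 1 colours and at most n parts, the last colour stays free for the part 1 added by the
    Pieri rule. *)
Definition colorings (c : 'I_n.+1 -> nat) : {set coloring} :=
  [set w : coloring | [forall k, #|[set x | w x == k]| == c k]].

Definition perm_coloring (s : 'S_n) (w : coloring) : coloring :=
  [ffun x => w (s^-1 x)%g].

Definition fixed_by (s : 'S_n) (w : coloring) := [forall x, w (s x) == w x].

Lemma coloringsP c w :
  reflect (forall k, #|[set x | w x == k]| = c k) (w \in colorings c).
Proof. by rewrite inE; apply: (iffP forallP) => h k; apply/eqP. Qed.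

Lemma perm_coloring1 w : perm_coloring 1%g w = w.
Proof. by apply/ffunP => x; rewrite ffunE invg1 perm1. Qed.

Lemma perm_coloringM s t w :
  perm_coloring (s * t)%g w = perm_coloring t (perm_coloring s w).
Proof. by apply/ffunP => x; rewrite !ffunE invMg permM. Qed.

Lemma perm_colorings c s w :
  w \in colorings c -> perm_coloring s w \in colorings c.
Proof.
move=> /coloringsP wc; apply/coloringsP => k; rewrite -wc.
rewrite -(card_imset [set x | w x == k] (@perm_inj _ s)).
apply: eq_card => x; rewrite !inE ffunE; apply/idP/imsetP => [h|[y]].
  by exists (s^-1 x)%g; rewrite ?inE ?permKV.
by rewrite inE => h ->; rewrite permK.
Qed.

Lemma perm_coloring_fixed s w : (perm_coloring s w == w) = fixed_by s w.
Proof.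
apply/eqP/forallP => [e x|h]; first by rewrite -{1}e ffunE permK.
by apply/ffunP => x; rewrite ffunE -{2}[x](permKV s) (eqP (h _)).
Qed.

Definition young_char (c : 'I_n.+1 -> nat) : 'CF(Sn_group n) :=
  action_char (Sn_group n) perm_coloring1 perm_coloringM (@perm_colorings c).

Lemma young_charE c s :
  young_char c s = (#|[set w in colorings c | fixed_by s w]|%:R)%R.
Proof.
rewrite action_charE ?inE //; congr (_%:R)%R; apply: eq_card => w.
by rewrite !inE perm_coloring_fixed.
Qed.

Lemma young_char_char c : young_char c \is a character.
Proof. exact: action_char_char. Qed.

Lemma eq_young_char c c' : c =1 c' -> young_char c = young_char c'.
Proof.
move=> e; apply/cfunP => s; rewrite !young_charE; congr (_%:R)%R; apply: eq_card => w.
by rewrite !inE; under eq_forallb do rewrite e.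
Qed.

Lemma young_char_perm c (p : {perm 'I_n.+1}) : young_char (c \o p) = young_char c.
Proof.
apply/cfunP => s; rewrite !young_charE; congr (_%:R)%R.
pose F (w : coloring) : coloring := [ffun x => p (w x)].
have F_inj : injective F.
  by move=> w w' /ffunP e; apply/ffunP => x; have := e x; rewrite !ffunE => /perm_inj.
rewrite -(card_imset _ F_inj); apply: eq_card => w.
have cF w' k : #|[set x | F w' x == p k]| = #|[set x | w' x == k]|.
  by apply: eq_card => x; rewrite !inE ffunE (inj_eq perm_inj).
have fF w' : fixed_by s (F w') = fixed_by s w'.
  by apply: eq_forallb => x; rewrite !ffunE (inj_eq perm_inj).
apply/imsetP/idP => [[w' h ->]|h].
  move: h; rewrite inE => /andP[/coloringsP wc fw]; rewrite inE fF fw andbT.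
  by apply/coloringsP => k; rewrite -[k](permKV p) cF wc.
have ew : w = F [ffun x => p^-1%g (w x)].
  by apply/ffunP => x; rewrite !ffunE permKV.
exists [ffun x => p^-1%g (w x)] => //.
move: h; rewrite {1}ew inE => /andP[/coloringsP wc]; rewrite fF => fw.
by rewrite inE fw andbT; apply/coloringsP => k; rewrite -cF wc.
Qed.

Definition recolor (w : coloring) x j : coloring := [ffun y => if y == x then j else w y].

Lemma recolor_id w x j : recolor (recolor w x j) x (w x) = w.
Proof. by apply/ffunP => y; rewrite !ffunE; case: eqP => [->|]. Qed.

Lemma card_recolor w x j k :
  #|[set y | recolor w x j y == k]| + (w x == k) = #|[set y | w y == k]| + (j == k).
Proof.
rewrite (cardsD1 x [set y | recolor w x j y == k]) (cardsD1 x [set y | w y == k]) !inE ffunE eqxx.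
suff -> : [set y | recolor w x j y == k] :\ x = [set y | w y == k] :\ x by lia.
by apply/setP => y; rewrite !inE ffunE; case: eqP.
Qed.

Lemma recolor_fixed (s : 'S_n) w x j : s x = x -> fixed_by s w -> fixed_by s (recolor w x j).
Proof.
move=> sx /forallP h; apply/forallP => y; rewrite !ffunE.
by rewrite -{1}sx (inj_eq perm_inj); case: ifP.
Qed.

Lemma card_recolorings (c c' : 'I_n.+1 -> nat) (i : 'I_n.+1) (s : 'S_n) :
  c ord_max = 0 -> c' ord_max = 1 -> i != ord_max ->
  (forall k, k != ord_max -> c' k + (k == i) = c k) ->
  #|[set p : coloring * 'I_n |
      [&& p.1 \in colorings c, fixed_by s p.1, s p.2 == p.2 & p.1 p.2 == i]]| =
  #|[set w in colorings c' | fixed_by s w]|.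
Proof.
move=> c0 c1 iM cc'.
pose F (p : coloring * 'I_n) := recolor p.1 p.2 ord_max.
have wM w x : w \in colorings c -> (w x == ord_max) = false.
  move=> /coloringsP/(_ ord_max); rewrite c0 => /eqP; rewrite cards_eq0 => /eqP/setP/(_ x).
  by rewrite !inE.
rewrite -(@card_in_imset _ _ F) => [|[w x] [w' x']]; last first.
  rewrite [(w, x) \in _]inE [(w', x') \in _]inE /=.
  move=> /and4P[wc _ _ /eqP wx] /and4P[wc' _ _ /eqP wx'] /ffunP e.
  have ex : x = x'.
    by have := e x; rewrite !ffunE /= eqxx; case: eqP => // _ /esym/eqP; rewrite (wM _ _ wc').
  subst x'; congr (_, _); apply/ffunP => y; have := e y; rewrite !ffunE /=.
  by case: eqP => [->|//]; rewrite wx wx'.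
apply: eq_card => w; apply/imsetP/idP => [[[w' x]]|].
  rewrite inE /= => /and4P[wc fw /eqP sx /eqP wx] ->.
  rewrite inE recolor_fixed // andbT; apply/coloringsP => k.
  have := card_recolor w' x ord_max k; rewrite wx => h.
  move/coloringsP: wc h => /(_ k) ->.
  case: (k =P ord_max) => [->|/eqP kM].
    by rewrite eqxx c0 c1 (negbTE iM) addn0 add0n.
  by rewrite -(cc' k kM) [ord_max == k]eq_sym (negbTE kM) (eq_sym i k) addn0 => /addIn.
rewrite inE => /andP[/coloringsP wc fw].
have /cards1P[x ex] : #|[set x | w x == ord_max]| == 1 by rewrite wc c1.
have wx : w x = ord_max by have := set11 x; rewrite -ex inE => /eqP.
have sx : s x = x.
  have : s x \in [set x] by rewrite -ex inE (eqP (forallP fw x)) wx.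
  by rewrite inE => /eqP.
exists (recolor w x i, x); last by rewrite /F /= -wx recolor_id.
rewrite inE /= sx eqxx recolor_fixed // ffunE eqxx eqxx !andbT.
apply/coloringsP => k; have := card_recolor w x i k; rewrite wx wc.
case: (k =P ord_max) => [->|/eqP kM].
  by rewrite eqxx c0 c1 (negbTE iM) addn1 addn0 => -[->].
by rewrite -(cc' k kM) [ord_max == k]eq_sym (negbTE kM) (eq_sym i k) addn0 => ->.
Qed.

(** The product counts pairs of a fixed colouring and a fixed point; sort them by the colour of the
    point. *)
Lemma perm_char_mul_young c (C : 'I_n.+1 -> 'I_n.+1 -> nat) :
  c ord_max = 0 -> (forall i, C i ord_max = 1) ->
  (forall i k, 0 < c i -> k != ord_max -> C i k + (k == i) = c k) ->
  (cfRepr (perm_repr n) * young_char c = \sum_(i | (0 < c i)%N) young_char (C i))%R.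
Proof.
move=> c0 C1 CC; apply/cfunP => s; rewrite sum_cfunE cfunE.
rewrite cfunE inE mulr1n /mxtrace.
under eq_bigr do rewrite !mxE.
rewrite young_charE -natr_sum -natrM.
under [RHS]eq_bigr do rewrite young_charE.
rewrite -natr_sum; congr (_%:R)%R.
have -> : (\sum_i (s i == i) = #|[set x | s x == x]|)%N.
  by rewrite -sum1dep_card [RHS]big_mkcond /=; apply: eq_bigr => x _; case: eqP.
rewrite mulnC -cardsX -sum1_card.
rewrite (partition_big (fun p : coloring * 'I_n => p.1 p.2) (fun i => 0 < c i)) /=.
  apply: eq_bigr => i ci; rewrite -(@card_recolorings c (C i) i s) //.
  - by rewrite sum1dep_card; apply: eq_card => -[w x]; rewrite !inE /= -!andbA.
  - by apply/eqP => e; rewrite e c0 in ci.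
  - by move=> k; apply: CC.
move=> [w x]; rewrite !inE /= => /andP[/andP[/forallP/(_ (w x))/eqP <- _] _].
by apply/card_gt0P; exists x; rewrite inE.
Qed.

End Colorings.

Lemma perm_eq_pos (s t : seq nat) : size s = size t ->
  perm_eq [seq x <- s | 0 < x] [seq x <- t | 0 < x] -> perm_eq s t.
Proof.
have zeros (u : seq nat) : [seq x <- u | ~~ (0 < x)] = nseq (size u - size [seq x <- u | 0 < x]) 0.
  rewrite -[in size u](count_predC (ltn 0) u) size_filter addKn -size_filter.
  by apply/all_pred1P/allP => x; rewrite mem_filter lt0n negbK => /andP[].
move=> est pe; rewrite -(perm_filterC (ltn 0) s) perm_sym -(perm_filterC (ltn 0) t).
rewrite perm_sym; apply: perm_cat => //.
by rewrite [X in perm_eq X _]zeros [X in perm_eq _ X]zeros est (perm_size pe).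
Qed.

Lemma mkseq_nth_pad (s : seq nat) m : size s <= m ->
  mkseq (nth 0 s) m = s ++ nseq (m - size s) 0.
Proof.
move=> sm; apply: (@eq_from_nth _ 0); first by rewrite size_mkseq size_cat size_nseq subnKC.
move=> i; rewrite size_mkseq => im; rewrite nth_mkseq // nth_cat.
by case: ltnP => // h; rewrite nth_default // nth_nseq; case: ifP.
Qed.

Section YoungSeq.

Variable n : nat.

Definition hchar (s : seq nat) := @young_char n (fun k => nth 0 s k).

Lemma hchar_perm s t : size s <= n.+1 -> size t <= n.+1 ->
  perm_eq [seq x <- s | 0 < x] [seq x <- t | 0 < x] -> hchar s = hchar t.
Proof.
move=> ss st pe.
have eT : tval [tuple nth 0 t k | k < n.+1] = mkseq (nth 0 t) n.+1.
  apply: (@eq_from_nth _ 0); rewrite ?size_tuple ?size_mkseq // => i im.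
  by rewrite nth_mkseq // -[i]/(val (Ordinal im)) -tnth_nth tnth_mktuple.
have pst : perm_eq (mkseq (nth 0 s) n.+1) [tuple nth 0 t k | k < n.+1].
  rewrite eT; apply: perm_eq_pos; first by rewrite !size_mkseq.
  rewrite !mkseq_nth_pad // !filter_cat.
  have z k : [seq x <- nseq k 0 | 0 < x] = [::] by elim: k.
  by rewrite !z !cats0.
have /tuple_permP[p ep] := pst.
have e (k : 'I_n.+1) : nth 0 s k = nth 0 t (p k).
  have := congr1 (fun u => nth 0 u k) ep; rewrite nth_mkseq //.
  by rewrite -tnth_nth !tnth_mktuple.
by rewrite /hchar (eq_young_char e) -(young_char_perm (fun k => nth 0 t k) p).
Qed.

Lemma perm_char_mul_hchar s : 0 < n -> is_part n s ->
  (cfRepr (perm_repr n) * hchar s =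
   \sum_(i < size s) hchar (norm_part (1%N :: set_nth 0%N s i (nth 0%N s i).-1)))%R.
Proof.
move=> n0 ps; have ss := size_part ps.
pose u i := set_nth 0 s i (nth 0 s i).-1.
pose C (i k : 'I_n.+1) := if k == ord_max then 1 else nth 0 (u i) k.
have nth0 (i : nat) : (0 < nth 0 s i) = (i < size s).
  by case: (ltnP i (size s)) => h; [rewrite (part_mem_pos ps) ?mem_nth|rewrite nth_default].
rewrite (@perm_char_mul_young n _ C); first last.
- move=> i k ci kM; rewrite /C (negbTE kM) /u nth_set_nth /=.
  by case: (k =P i) => [->|ki]; [rewrite eqxx addn1 prednK|case: eqP => [/val_inj//|_]; rewrite addn0].
- by move=> i; rewrite /C eqxx.
- by rewrite nth_default.
under eq_bigl do rewrite nth0.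
pose D (i : nat) (k : 'I_n.+1) := if k == ord_max then 1 else nth 0 (u i) k.
rewrite -(big_ord_widen n.+1 (fun i => young_char (D i))) ?(leq_trans ss) //.
apply: eq_bigr => i _.
have su : size (u i) <= n by rewrite size_set_nth (maxn_idPr _).
have sumu : sumn (1 :: u i) = n.
  rewrite /= sumn_set_nth_ltn // (is_part_sum ps).
  have := leq_nth_sumn s i; have := nth0 i; rewrite ltn_ord (is_part_sum ps).
  by move: (nth 0 s i) => a; clear; lia.
have -> : young_char (D i) = hchar (rcons (mkseq (nth 0 (u i)) n) 1).
  apply: eq_young_char => k; rewrite /D nth_rcons size_mkseq -val_eqE /=.
  case: eqP => [->|/eqP kn]; first by rewrite ltnn ?eqxx.
  have kn' : k < n by rewrite ltn_neqAle kn -ltnS ltn_ord.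
  by rewrite kn' nth_mkseq.
apply: hchar_perm.
- by rewrite size_rcons size_mkseq.
- exact: leq_trans (size_part (norm_part_part sumu)) _.
rewrite mkseq_nth_pad // filter_rcons filter_cat.
have z k : [seq x <- nseq k 0 | 0 < x] = [::] by elim: k.
rewrite z cats0 /= perm_rcons /norm_part.
have /all_filterP -> : all (ltn 0) (sort geq [seq x <- 1 :: u i | 0 < x]).
  by rewrite all_sort filter_all.
by rewrite perm_sym perm_sort.
Qed.

End YoungSeq.

(** * Unimodularity of the Young characters *)

Lemma sign_mx_repr n :
  mx_repr (Sn_group n) (fun s : 'S_n => ((-1) ^+ s)%:M%R : 'M[algC]_1).
Proof.
split=> [|s t _ _]; first by rewrite odd_perm1.
by rewrite odd_permM signr_addb -scalar_mxM.
Qed.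

Definition sign_char n : 'CF(Sn_group n) := cfRepr (MxRepresentation (@sign_mx_repr n)).

Lemma sign_charE n (s : 'S_n) : (sign_char n s = (-1) ^+ s)%R.
Proof. by rewrite cfunE inE mulr1n mxtrace_scalar. Qed.

Section Pairing.

Variable n : nat.
Local Notation coloring := {ffun 'I_n -> 'I_n.+1}.
Implicit Types p : coloring * coloring.

Definition pair_inj p := injectiveb (fun x => (p.1 x, p.2 x)).

(** Labelled points in distinct cells: each 0-1 matrix with n ones and these row and column sums
    underlies n! placements. *)
Definition placements (c d : 'I_n.+1 -> nat) : {set coloring * coloring} :=
  [set p | [&& p.1 \in colorings c, p.2 \in colorings d & pair_inj p]].

(* A transposition of two points with equal colours pairs off the permutations
   fixing both colourings with opposite signs. *)
Lemma sum_sign_fixed p :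
  (\sum_(s : 'S_n | fixed_by s p.1 && fixed_by s p.2) (-1) ^+ s = (pair_inj p)%:R :> algC)%R.
Proof.
case: (boolP (pair_inj p)) => [/injectiveP pi|].
  rewrite (big_pred1 1%g) ?odd_perm1 // => s; apply/andP/eqP => [[/forallP f1 /forallP f2]|->].
    by apply/permP => x; apply: pi; rewrite perm1 (eqP (f1 x)) (eqP (f2 x)).
  by split; apply/forallP => x; rewrite perm1.
case/injectivePn=> x [y xy [e1 e2]].
set S := (X in X = _).
suff : (S = - S)%R.
  by move/eqP; rewrite -addr_eq0 -mulr2n mulrn_eq0 /= => /eqP.
rewrite {1}/S (reindex_inj (mulgI (tperm x y))) -sumrN.
have ft (w : coloring) s : w x = w y -> fixed_by (tperm x y * s)%g w = fixed_by s w.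
  move=> e; have wt z : w (tperm x y z) = w z by case: tpermP => // ->.
  apply/forallP/forallP => h z.
    by have := h (tperm x y z); rewrite permM tpermK wt.
  by rewrite permM -[X in _ == X]wt.
apply: eq_big => s; first by rewrite !ft.
by rewrite odd_permM odd_tperm xy signr_addb mulN1r.
Qed.

(** Exchange the sums over permutations and pairs of colourings: the inner sum of signs over the
    stabiliser of a pair is 1 or 0. *)
Lemma cfdot_young_sign c d :
  ('[young_char c, sign_char n * young_char d] = #|placements c d|%:R / n`!%:R)%R.
Proof.
rewrite cfdotE mulrC cardsT card_Sn; congr (_ / _)%R.
transitivity (\sum_(s : 'S_n) \sum_(p | (p.1 \in colorings c) && (p.2 \in colorings d))
    if fixed_by s p.1 && fixed_by s p.2 then (-1) ^+ s : algC else 0)%R.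
  apply: eq_big => [s|s _]; first by rewrite inE.
  rewrite young_charE cfunE sign_charE young_charE rmorphM rmorph_sign rmorph_nat mulrCA -natrM -cardsX.
  rewrite -big_mkcondr /= sumr_const mulr_natr; congr (_ *+ _)%R.
  by apply: eq_card => -[w v]; rewrite [RHS]unfold_in /= in_setX !inE -!andbA; congr (_ && _); rewrite andbCA.
rewrite exchange_big /=; under eq_bigr do rewrite -big_mkcond sum_sign_fixed.
rewrite -natr_sum -big_mkcondr sum1dep_card; congr (_%:R)%R.
by apply: eq_card => p; rewrite !inE -andbA.
Qed.

End Pairing.

(** * Placements and the dominance order *)

Lemma minn_count (s : seq nat) r j : sorted geq s ->
  minn r (count (ltn j) s) = count (ltn j) (take r s).
Proof.
elim: s r => [|a s IH] [|r] //=; rewrite ?min0n ?minn0 //.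
rewrite path_sortedE; last exact: geq_trans.
case/andP=> sa ss; rewrite -IH //; case: (ltnP j a) => ja; first by rewrite !add1n minnSS.
have -> : count (ltn j) s = 0.
  by apply/eqP; rewrite -leqn0 leqNgt -has_count; apply/hasPn => x /(allP sa) /=; clear - ja; lia.
by rewrite !minn0.
Qed.

Lemma sum_count_ltn (s : seq nat) n : all (geq n) s ->
  \sum_(j < n) count (ltn j) s = sumn s.
Proof.
elim: s => [|a s IH] /=; first by rewrite big1.
case/andP=> an sn; rewrite big_split /= IH //; congr (_ + _).
rewrite -(big_mkord xpredT (fun j => (j < a) : nat)) (big_cat_nat (n := a)) //=.
rewrite big_nat (eq_bigr (fun=> 1)) => [|j /andP[_ ->//]].
rewrite -big_nat sum_nat_const_nat subn0 muln1 big_nat big1 ?addn0 // => j /andP[aj _].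
by rewrite ltnNge aj.
Qed.

Lemma sum_nth_take (s : seq nat) n r : r <= n ->
  \sum_(k < n | k < r) nth 0 s k = sumn (take r s).
Proof.
move=> rn; rewrite -(big_ord_widen n (nth 0 s)) // {n rn}.
elim: s r => [|a s IH] [|r]; rewrite ?big_ord0 //=.
  by rewrite big1 // => i _; rewrite nth_nil.
by rewrite big_ord_recl IH.
Qed.

Section Dominance.

Variables (n : nat) (m l : seq nat).
Hypotheses (pm : is_part n m) (pl : is_part n l).

(** The parts of the conjugate partition, indexed from 0. *)
Definition conj_content (s : seq nat) (j : nat) := count (ltn j) s.

Variable p : {ffun 'I_n -> 'I_n.+1} * {ffun 'I_n -> 'I_n.+1}.
Hypothesis pP : p \in placements (nth 0 m) (conj_content l).

Let N r (j : 'I_n.+1) := #|[set x | (p.1 x < r) && (p.2 x == j)]|.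

(** A column holds at most one point per row, so its first r rows hold at most the minimum of r and
    the column sum; this minimum counts the parts above j among the first r. *)
Lemma placement_leq r j : N r j <= count (ltn j) (take r l).
Proof.
move: pP; rewrite inE => /and3P[/coloringsP c1 /coloringsP c2 /injectiveP pi].
rewrite -minn_count; last exact: is_part_sorted pl.
rewrite leq_min; apply/andP; split; last first.
  have <- : #|[set x | p.2 x == j]| = count (ltn j) l := c2 j.
  by apply/subset_leq_card/subsetP => x; rewrite !inE => /andP[].
rewrite -[X in _ <= X](size_iota 0 r).
rewrite /N cardE -(size_map (fun x => val (p.1 x))); apply: uniq_leq_size.
  rewrite map_inj_in_uniq ?enum_uniq // => x y; rewrite !mem_enum !inE.
  move=> /andP[_ /eqP xj] /andP[_ /eqP yj] /val_inj e.
  by apply: pi; rewrite e xj yj.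
by move=> k /mapP[x]; rewrite mem_enum inE mem_iota add0n => /andP[h _] ->.
Qed.

Lemma sum_placement r : r <= n.+1 -> \sum_j N r j = sumn (take r m).
Proof.
move=> rn; move: pP; rewrite inE => /and3P[/coloringsP c1 _ _].
rewrite -(sum_nth_take _ rn).
transitivity #|[set x | p.1 x < r]|.
  rewrite -sum1dep_card (partition_big p.2 xpredT) //=.
  by apply: eq_bigr => j _; rewrite sum1dep_card.
rewrite -sum1dep_card (partition_big p.1 (fun k => k < r)) //=.
apply: eq_bigr => k kr; rewrite -c1 sum1dep_card; apply: eq_card => x; rewrite !inE.
by case: eqP => [->|]; rewrite ?kr ?andbF.
Qed.

Lemma sum_count_take r : \sum_(j < n.+1) count (ltn j) (take r l) = sumn (take r l).
Proof.
apply: sum_count_ltn; apply/allP => x /mem_take /(part_leq pl) /= h.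
exact: leq_trans h _.
Qed.

Lemma placement_dominance r : r <= n.+1 -> sumn (take r m) <= sumn (take r l).
Proof.
move=> rn; rewrite -sum_placement // -sum_count_take; apply: leq_sum => j _.
exact: placement_leq.
Qed.

End Dominance.

(** When both partitions are l, all column bounds are attained, since their totals agree. Passing
    row p.1 x adds a point to column p.2 x, so that row of l must be longer than p.2 x. *)
Lemma placement_in_diagram n l p x : is_part n l ->
  p \in @placements n (nth 0 l) (conj_content l) -> p.2 x < nth 0 l (p.1 x).
Proof.
move=> pl pp.
have NE r (j : 'I_n.+1) : r <= n.+1 ->
    #|[set x | (p.1 x < r) && (p.2 x == j)]| = count (ltn j) (take r l).
  move=> rn; have := sum_placement pp rn; rewrite -(sum_count_take pl) => /eqP.
  have := leqif_sum (fun j (_ : true) => leqif_eq (placement_leq pl pp r j)).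
  by move=> [_ ->] /forallP/(_ j)/eqP.
set r : nat := p.1 x; have h1 := NE r (p.2 x) (ltnW (ltn_ord _)).
have h2 := NE r.+1 (p.2 x) (ltn_ord _).
have : #|[set y | (p.1 y < r) && (p.2 y == p.2 x)]| < #|[set y | (p.1 y < r.+1) && (p.2 y == p.2 x)]|.
  apply: proper_card; apply/properP; split.
    by apply/subsetP => y; rewrite !inE => /andP[h ->]; rewrite ltnS ltnW.
  by exists x; rewrite !inE ?ltnn ?leqnn ?eqxx.
rewrite h1 h2; case: (ltnP r (size l)) => rl; last first.
  by rewrite !take_oversize ?ltnn // ltnW.
by rewrite (take_nth 0 rl) -cats1 count_cat /= addn0 -[X in X < _]addn0 ltn_add2l lt0b.
Qed.

(** The placements are exactly the injections of the n points into the n cells of the Young diagram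
    of l. *)
Lemma card_placements n l : is_part n l ->
  #|@placements n (nth 0 l) (conj_content l)| = n`!.
Proof.
move=> pl.
pose D : {set 'I_n.+1 * 'I_n.+1} :=
  [set q : 'I_n.+1 * 'I_n.+1 | q.2 < nth 0 l q.1].
have row (k : 'I_n.+1) : #|[set j : 'I_n.+1 | j < nth 0 l k]| = nth 0 l k.
  rewrite -sum1dep_card -(big_ord_widen n.+1 (fun=> 1)); last first.
    exact: leq_trans (part_nth_leq k pl) _.
  by rewrite sum_nat_const card_ord muln1.
have col (j : 'I_n.+1) : #|[set k : 'I_n.+1 | j < nth 0 l k]| = conj_content l j.
  have sl : size l <= n.+1 by apply: leq_trans (size_part pl) _.
  rewrite /conj_content -[RHS]sum1_count (big_nth 0) big_mkord.
  rewrite (big_ord_widen_cond n.+1 (fun i => j < nth 0 l i) (fun=> 1)) // sum1dep_card.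
  apply: eq_card => k; rewrite !inE; case: (ltnP k (size l)) => kl; rewrite ?andbT //.
  by rewrite nth_default.
have cD : #|D| = n.
  rewrite -sum1dep_card -(pair_big_dep xpredT
    (fun k j : 'I_n.+1 => j < nth 0 l k) (fun _ _ => 1)) /=.
  under eq_bigr do rewrite sum1dep_card row.
  rewrite (eq_bigl (fun k : 'I_n.+1 => k < n.+1)) => [|k]; last by rewrite ltn_ord.
  rewrite sum_nth_take // take_oversize ?(is_part_sum pl) //.
  exact: leq_trans (size_part pl) _.
pose F (p : {ffun 'I_n -> 'I_n.+1} * {ffun 'I_n -> 'I_n.+1}) :
  {ffun 'I_n -> 'I_n.+1 * 'I_n.+1} := [ffun x => (p.1 x, p.2 x)].
have F_inj : injective F.
  move=> [w v] [w' v'] /ffunP e; congr (_, _); apply/ffunP => x;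
    by have := e x; rewrite !ffunE => -[].
rewrite -(card_imset _ F_inj).
have -> : n`! = #|[set f : {ffun 'I_n -> 'I_n.+1 * 'I_n.+1} in ffun_on (mem D) | injectiveb f]|.
  by rewrite card_inj_ffuns_on cD card_ord ffactnn.
apply: eq_card => f; rewrite inE; apply/imsetP/andP => [[p pp ->]|[/ffun_onP fD /injectiveP fi]].
  split; first by apply/ffun_onP => x; rewrite ffunE inE placement_in_diagram.
  move: pp; rewrite inE => /and3P[_ _ /injectiveP pi]; apply/injectiveP => x y.
  by rewrite !ffunE; apply: pi.
(* Such an injection is onto, so row and column contents can be counted on the cells. *)
have fT : f @: setT = D.
  apply/eqP; rewrite eqEcard card_imset // cardsT card_ord cD leqnn andbT.
  by apply/subsetP => q /imsetP[x _ ->]; apply: fD.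
have cf (P : pred ('I_n.+1 * 'I_n.+1)) : #|[set x | P (f x)]| = #|[set q in D | P q]|.
  rewrite -(card_imset _ fi); apply: eq_card => q; rewrite inE -fT.
  apply/imsetP/andP => [[x]|[/imsetP[x _ ->] Px]].
    by rewrite inE => Px ->; rewrite imset_f.
  by exists x; rewrite ?inE.
exists ([ffun x => (f x).1], [ffun x => (f x).2]); last first.
  by apply/ffunP => x; rewrite !ffunE; case: (f x).
rewrite inE /=; apply/and3P; split.
- apply/coloringsP => k; under eq_finset do rewrite ffunE.
  rewrite (cf (fun q => q.1 == k)) -[RHS]row.
  have pj : injective (fun j : 'I_n.+1 => (k, j)) by move=> a b [].
  rewrite -(card_imset _ pj); apply: eq_card => -[a b]; rewrite !inE /=.
  apply/andP/imsetP => [[h /eqP ea]|[j]]; first by exists b; rewrite ?inE -?ea.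
  by rewrite inE => h [-> ->].
- apply/coloringsP => j; under eq_finset do rewrite ffunE.
  rewrite (cf (fun q => q.2 == j)) -[RHS]col.
  have pj : injective (fun k : 'I_n.+1 => (k, j)) by move=> a b [].
  rewrite -(card_imset _ pj); apply: eq_card => -[a b]; rewrite !inE /=.
  apply/andP/imsetP => [[h /eqP eb]|[k]]; first by exists a; rewrite ?inE -?eb.
  by rewrite inE => h [-> ->].
- apply/injectiveP => x y; rewrite /= !ffunE => -[e1 e2]; apply: fi.
  by move: e1 e2; case: (f x) => a b; case: (f y) => a' b' /= -> ->.
Qed.

(** A numerical rank that strictly increases along the dominance order. *)
Definition partial_sums n (s : seq nat) := \sum_(r < n.+1) sumn (take r s).

Lemma nth_take_sum (s : seq nat) r : nth 0 s r + sumn (take r s) = sumn (take r.+1 s).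
Proof.
by elim: s r => [|a s IH] [|r] //=; rewrite ?take0 // -IH addnCA.
Qed.

Lemma part_nth_inj n s t : is_part n s -> is_part n t ->
  (forall r, r < n -> nth 0 s r = nth 0 t r) -> s = t.
Proof.
move=> ps pt e.
have pos u : is_part n u -> u = [seq x <- mkseq (nth 0 u) n | 0 < x].
  move=> pu; rewrite mkseq_nth_pad ?(size_part pu) // filter_cat.
  rewrite (all_filterP (is_part_pos pu)).
  by elim: (n - size u) => [|k IH] //=; rewrite cats0.
rewrite (pos s ps) (pos t pt); congr filter; apply/eq_in_map => r.
by rewrite mem_iota => /andP[_]; apply: e.
Qed.

Lemma placement_partial_sums n m l : is_part n m -> is_part n l -> m != l ->
  0 < #|@placements n (nth 0 m) (conj_content l)| ->
  partial_sums n m < partial_sums n l.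
Proof.
move=> pm pl ml /card_gt0P[p pp].
have h (r : 'I_n.+1) (_ : true) := leqif_eq (placement_dominance pl pp (ltnW (ltn_ord r))).
have [le1 le2] := leqif_sum h.
rewrite ltn_neqAle le1 andbT; apply: contra ml; rewrite le2 => /forallP e.
have e' r : r <= n -> sumn (take r m) = sumn (take r l).
  by move=> rn; have := e (Ordinal (rn : r < n.+1)) => /eqP.
apply/eqP/(part_nth_inj pm pl) => r rn.
have := nth_take_sum m r; rewrite (e' r (ltnW rn)) (e' _ rn) -nth_take_sum.
exact: addIn.
Qed.

(** * Integer matrices *)

Local Open Scope ring_scope.

(** Row i of A is the i-th unit vector plus multiples of unit vectors of larger rank, which lie in
    the row span by induction from the top rank downwards. *)
Lemma unitriangular_unitmx (R : comUnitRingType) m (A : 'M[R]_m) (rk : 'I_m -> nat) :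
  (forall i, A i i = 1) -> (forall i j, i != j -> A i j != 0 -> (rk i < rk j)%N) ->
  A \in unitmx.
Proof.
move=> A1 A0.
have im i : exists u : 'rV_m, u *m A = delta_mx 0 i.
  pose b := (\max_j rk j).+1%N.
  have [d] := ubnP (b - rk i); elim: d i => // d IH i hd.
  suff [u eu] : exists u : 'rV_m, u *m A = \sum_(j | j != i) A i j *: delta_mx 0 j.
    exists (delta_mx 0 i - u); rewrite mulmxBl eu -rowE [row i A]row_sum_delta.
    rewrite (bigD1 i) //= mxE A1 scale1r; under eq_bigr do rewrite mxE.
    by rewrite addrK.
  apply: (big_ind (fun v => exists u : 'rV_m, u *m A = v)).
  - by exists 0; rewrite mul0mx.
  - by move=> v v' [u <-] [u' <-]; exists (u + u'); rewrite mulmxDl.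
  move=> j ji; have [->|Aij] := eqVneq (A i j) 0.
    by exists 0; rewrite mul0mx scale0r.
  have rij : (rk i < rk j)%N by apply: A0 => //; rewrite eq_sym.
  have [|u eu] := IH j; last by exists (A i j *: u); rewrite -scalemxAl eu.
  have : (rk j < b)%N by rewrite ltnS; apply: leq_bigmax.
  by move: rij hd; clear; lia.
have [|f Hf] := @fin_choice _ _ (fun i (u : 'rV_m) => u *m A = delta_mx 0 i) 0 (enum 'I_m).
  by move=> i _; apply: im.
have /mulmx1_unit[] : (\matrix_i f i) *m A = 1%:M; last by [].
by apply/row_matrixP => i; rewrite row_mul rowK Hf ?mem_enum // row1.
Qed.

Lemma mulmx1C_rect (R : comUnitRingType) m p (A : 'M[R]_(m, p)) (B : 'M[R]_(p, m)) :
  m = p -> A *m B = 1%:M -> B *m A = 1%:M.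
Proof. by move=> e; case: p / e A B => A B; apply: mulmx1C. Qed.

(** * Deleting the row and column of index 0 *)

Section DeleteIndex.

Variables (l k : nat) (A : 'M[int]_l.+1) (d : 'rV[int]_l.+1).
Variables (phi : 'I_k -> {additive 'rV[int]_l.+1 -> int}) (q : 'I_k -> int).

Let deg (v : 'rV[int]_l.+1) := (v *m d^T) 0 0.

Hypothesis d0 : d 0 0 = 1.
Hypothesis dA : d *m A = 0.
Hypothesis degA : forall v, deg (v *m A) = 0.
Hypothesis phi_surj : forall c : 'I_k -> int,
  exists2 v, deg v = 0 & forall i, phi i v = c i.
Hypothesis phi_ker : forall v, (exists z, v = z *m A) <->
  deg v = 0 /\ forall i, (q i %| phi i v)%Z.

Let low (v : 'rV[int]_l.+1) : 'cV[int]_l := \col_i v 0 (lift 0 i).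

(** The degree-0 vector with prescribed coordinates away from index 0; it is integral because d_0 =
    1. *)
Let hat (x : 'cV[int]_l) : 'rV[int]_l.+1 :=
  \row_j (if unlift 0 j is Some i then x i 0 else - \sum_i x i 0 * d 0 (lift 0 i)).

Let low_hat x : low (hat x) = x.
Proof. by apply/colP => i; rewrite !mxE liftK. Qed.

Let degE v : deg v = v 0 0 + \sum_i v 0 (lift 0 i) * d 0 (lift 0 i).
Proof.
rewrite /deg mxE big_ord_recl mxE d0 mulr1; congr (_ + _).
by apply: eq_bigr => i _; rewrite mxE.
Qed.

Let deg_hat x : deg (hat x) = 0.
Proof.
rewrite degE mxE unlift_none addrC; apply/eqP; rewrite subr_eq0; apply/eqP.
by apply: eq_bigr => i _; rewrite mxE liftK.
Qed.

Let low_inj v w : deg v = 0 -> deg w = 0 -> low v = low w -> v = w.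
Proof.
rewrite !degE => /eqP; rewrite addr_eq0 => /eqP v0 /eqP; rewrite addr_eq0 => /eqP w0 /colP e.
have e' i : v 0 (lift 0 i) = w 0 (lift 0 i) by have := e i; rewrite !mxE.
apply/rowP => j; case: (unliftP 0 j) => [i|] ->; first exact: e'.
by rewrite v0 w0; congr (- _); apply: eq_bigr => i _; rewrite e'.
Qed.

Let hatE x : hat x = \sum_j hat (delta_mx j 0) *~ x j 0.
Proof.
have hatD (a b : 'cV[int]_l) : hat (a - b) = hat a - hat b.
  apply/rowP => j; rewrite !mxE; case: unlift => [i|]; first by rewrite !mxE.
  rewrite opprK [RHS]addrC -[RHS]opprB -sumrB; congr (- _); apply: eq_bigr => i _ /=.
  by rewrite !mxE mulrBl.
pose hat_add : {additive 'cV[int]_l -> 'rV[int]_l.+1} :=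
  HB.pack hat (GRing.isAdditive.Build _ _ hat hatD).
rewrite {1}[x]matrix_sum_delta -[hat]/(hat_add : _ -> _) raddf_sum; apply: eq_bigr => j _.
by rewrite big_ord1 -{1}[x j 0]intz scaler_int raddfMz.
Qed.

Let mul_low (z : 'rV[int]_l.+1) : z 0 0 = 0 ->
  (\matrix_(i, j) A (lift 0 i) (lift 0 j))^T *m low z = low (z *m A).
Proof.
move=> z0; apply/colP => i; rewrite !mxE big_ord_recl z0 mul0r add0r.
by apply: eq_bigr => j _; rewrite !mxE mulrC.
Qed.

(** [low] and [hat] identify the degree-0 lattice with the columns of length l. A preimage can be
    shifted by a multiple of d, which A kills, to have coordinate 0 at index 0; on such vectors the
    reduced matrix acts as A does. *)
Lemma coker_iso_delete : coker_iso (\matrix_(i, j) A (lift 0 i) (lift 0 j))^T q.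
Proof.
pose F : 'M[int]_(k, l) := \matrix_(i, j) phi i (hat (delta_mx j 0)).
have FE x i : (F *m x) i ord0 = phi i (hat x).
  rewrite mxE hatE raddf_sum; apply: eq_bigr => j _.
  by rewrite mxE raddfMz -mulrzr intz.
exists F; split=> [t|x].
  have [v v0 vt] := phi_surj (fun i => t i 0).
  exists (low v) => i; rewrite FE.
  by rewrite (low_inj (deg_hat _) v0 (low_hat _)) vt eqxx.
have kerE : (forall i, (q i %| (F *m x) i ord0)%Z) <-> exists z, hat x = z *m A.
  split=> [h|/phi_ker[_ h] i]; last by rewrite FE.
  by apply/phi_ker; split=> [|i]; [apply: deg_hat|rewrite -FE].
split=> [/kerE[z ez]|[z ez]].
  pose z' := z - z 0 0 *: d.
  exists (low z'); rewrite mul_low; last by rewrite !mxE d0 mulr1 subrr.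
  by rewrite mulmxBl -scalemxAl dA scaler0 subr0 -ez low_hat.
apply/kerE; pose z' : 'rV[int]_l.+1 := \row_j (if unlift 0 j is Some i then z i 0 else 0).
have z'0 : z' 0 0 = 0 by rewrite mxE unlift_none.
have lz : low z' = z by apply/colP => i; rewrite !mxE liftK.
exists z'; apply: low_inj; [exact: deg_hat|exact: degA|].
by rewrite low_hat -mul_low // lz.
Qed.

End DeleteIndex.

(** * The McKay-Cartan matrix of the reflection representation *)

Section Coordinates.

Variables (gT : finGroupType) (G : {group gT}).

(** For a character these inner products are integers, so the floor only changes the type. *)
Definition irr_coord (phi : 'CF(G)) : 'rV[int]_(Nirr G) :=
  \row_j Num.Def.floor '[phi, 'chi_j].

Definition irr_comb (v : 'rV[int]_(Nirr G)) : 'CF(G) := \sum_j (v 0 j)%:~R *: 'chi_j.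

Lemma irr_combB u v : irr_comb (u - v) = irr_comb u - irr_comb v.
Proof.
rewrite /irr_comb -sumrB; apply: eq_bigr => j _.
by rewrite !mxE rmorphB scalerBl.
Qed.

HB.instance Definition _ :=
  GRing.isAdditive.Build 'rV[int]_(Nirr G) 'CF(G) irr_comb irr_combB.

Lemma cfdot_irr_comb v j : '[irr_comb v, 'chi_j] = (v 0 j)%:~R.
Proof.
rewrite cfdot_suml (bigD1 j) //= cfdotZl cfnorm_irr mulr1 big1 ?addr0 // => i ij.
by rewrite cfdotZl cfdot_irr (negbTE ij) mulr0.
Qed.

Lemma irr_comb_inj : injective irr_comb.
Proof.
move=> u v e; apply/rowP => j; apply: (@intr_inj algC).
by rewrite -!cfdot_irr_comb e.
Qed.

Lemma irr_coordE phi j : phi \is a character ->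
  (irr_coord phi 0 j)%:~R = '[phi, 'chi_j].
Proof. by move=> /char_vchar pc; rewrite mxE floorK // Cint_cfdot_vchar_irr. Qed.

Lemma irr_coordK phi : phi \is a character -> irr_comb (irr_coord phi) = phi.
Proof.
move=> pc; rewrite [RHS]cfun_sum_cfdot; apply: eq_bigr => j _.
by rewrite irr_coordE.
Qed.

Lemma irr_comb_mul chi (M : 'M[int]_(Nirr G)) v :
  (forall i, chi * 'chi_i = \sum_j (M i j)%:~R *: 'chi_j) ->
  irr_comb (v *m M) = chi * irr_comb v.
Proof.
move=> hM; rewrite /irr_comb mulr_sumr.
under [RHS]eq_bigr do rewrite -scalerAr hM scaler_sumr.
rewrite exchange_big; apply: eq_bigr => j _ /=.
rewrite mxE rmorph_sum scaler_suml; apply: eq_bigr => i _.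
by rewrite rmorphM scalerA.
Qed.

Definition irr_deg : 'rV[int]_(Nirr G) := \row_j Num.Def.floor ('chi[G]_j 1%g).

Lemma irr_degE j : (irr_deg 0 j)%:~R = 'chi[G]_j 1%g.
Proof. by rewrite mxE floorK // irr1_degree natr_int. Qed.

End Coordinates.

(** * The lattice of virtual characters and its chain basis *)

Section Lattice.

Variable n : nat.
Hypothesis n1 : (1 < n)%N.

Local Notation G := (Sn_group n).
Local Notation p := (size (parts n)).
Local Notation part i := (nth [::] (parts n) i).

Lemma partP (i : 'I_p) : is_part n (part i).
Proof. by rewrite -mem_parts mem_nth. Qed.

Definition hvec (s : seq nat) : 'rV[int]_(Nirr G) := irr_coord (hchar n s).

Definition evec (s : seq nat) : 'rV[int]_(Nirr G) :=
  irr_coord (sign_char n * @young_char n (conj_content s)).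

Lemma hvecK s : irr_comb (hvec s) = hchar n s.
Proof. by rewrite irr_coordK // young_char_char. Qed.

Lemma cfdot_hvec_evec s t :
  (\sum_j hvec s 0 j * evec t 0 j)%:~R =
  #|@placements n (nth 0%N s) (conj_content t)|%:R / n`!%:R :> algC.
Proof.
rewrite -cfdot_young_sign cfdot_sum_irr rmorph_sum; apply: eq_bigr => j _.
have ec : sign_char n * @young_char n (conj_content t) \is a character.
  by rewrite rpredM ?young_char_char ?cfRepr_char.
by rewrite rmorphM /= -!irr_coordE ?young_char_char // rmorph_int.
Qed.

(** Diagonal entries are n!/n! = 1, and a nonzero entry off the diagonal forces strictly increasing
    [partial_sums]. *)
Lemma gram_unitmx :
  (\matrix_(i < p) hvec (part i)) *m (\matrix_(i < p) evec (part i))^T \in unitmx.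
Proof.
set A := _ *m _.
have AE i j : (A i j)%:~R =
    #|@placements n (nth 0%N (part i)) (conj_content (part j))|%:R / n`!%:R :> algC.
  rewrite -cfdot_hvec_evec mxE; congr (_%:~R); apply: eq_bigr => k _.
  by rewrite mxE [(_^T) _ _]mxE [in X in _ * X]mxE.
have nf : n`!%:R != 0 :> algC by rewrite pnatr_eq0 -lt0n fact_gt0.
apply: (@unitriangular_unitmx _ _ _ (fun i => partial_sums n (part i))) => [i|i j ij Aij].
  by apply: (@intr_inj algC); rewrite AE card_placements ?partP // divff.
apply: placement_partial_sums; rewrite ?partP //.
  by rewrite nth_uniq ?parts_uniq.
rewrite lt0n; apply: contra Aij => /eqP e.
by rewrite -(eqr_int algC) AE e mul0r.
Qed.

(** A right inverse gives p(n) at most the number of irreducible characters; the bound by cycle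
    types makes the matrix square, so the inverse is two-sided. *)
Lemma hvec_basis : p = Nirr G /\
  exists K : 'M[int]_(Nirr G, p), K *m (\matrix_(i < p) hvec (part i)) = 1%:M.
Proof.
set H := (\matrix_i _); have := gram_unitmx; rewrite -/H; set E := (_^T) => u.
have e1 : H *m (E *m invmx (H *m E)) = 1%:M by rewrite mulmxA mulmxV.
have ep : p = Nirr G.
  by apply/eqP; rewrite eqn_leq (mulmx1_min e1) Nirr_leq_parts.
by split=> //; exists (E *m invmx (H *m E)); apply: mulmx1C_rect e1.
Qed.

Variable M : 'M[int]_(Nirr G).
Hypothesis hM : forall i : Iirr G, refl_char n * 'chi_i = \sum_j (M i j)%:~R *: 'chi_j.

Local Notation chi_perm := (cfRepr (perm_repr n)).

Lemma irr_comb_perm v : irr_comb (v *m (M + 1%:M)) = chi_perm * irr_comb v.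
Proof.
apply: irr_comb_mul => i; rewrite -[chi_perm](subrK 1) mulrDl mul1r [_ * _]hM.
rewrite [RHS](eq_bigr (fun j => (M i j)%:~R *: 'chi_j + (1%:M i j : int)%:~R *: 'chi_j)); last first.
  by move=> j _; rewrite [(M + _) i j]mxE intrD scalerDl.
rewrite big_split /=; congr (_ + _); rewrite (bigD1 i) //= mxE eqxx scale1r big1 ?addr0 // => j ji.
by rewrite mxE eq_sym (negbTE ji) scale0r.
Qed.

Lemma mul_hvec s : is_part n s -> hvec s *m (M + 1%:M) =
  \sum_(i < size s) hvec (norm_part (1%N :: set_nth 0%N s i (nth 0%N s i).-1)).
Proof.
move=> ps; apply: irr_comb_inj; rewrite irr_comb_perm hvecK.
rewrite perm_char_mul_hchar //; last exact: ltnW.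
by rewrite raddf_sum; apply: eq_bigr => i _; rewrite /= hvecK.
Qed.

(** [chain_exists] is applied to M + 1, which is multiplication by the permutation character. By
    unitriangularity each h lies in the span of g, by induction from the largest first part
    downwards, and the h span the lattice. *)
Lemma chain_basis : exists2 g : seq nat -> 'rV[int]_(Nirr G),
  forall s, is_part n s -> g s *m ((n.-1)%:Z%:M - M) =
    g s *+ (n - count_mem 1%N s) - (if desc s then g (nxt s) else 0)
  & exists Y : 'M[int]_(Nirr G, p),
    Y *m (\matrix_(i < p) g (part i)) = 1%:M /\
    (\matrix_(i < p) g (part i)) *m Y = 1%:M.
Proof.
have [g Hg] := @chain_exists n _ (mulmxr (M + 1%:M)) hvec n1 mul_hvec.
exists g => [s ps|].
  have [_ /= e] := Hg s ps.
  have cs : (count_mem 1%N s <= n)%N := leq_trans (count_size _ _) (size_part ps).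
  rewrite -e mulrnBr // opprB addrA subrK.
  have {1}-> : M = (M + 1%:M) - 1%:M by rewrite addrK.
  rewrite opprB addrA -raddfD /= -[1 : int]/(1%N%:Z) -PoszD addn1 prednK ?mulmxBr; last exact: ltnW.
  by rewrite mul_mx_scalar -natz scaler_nat.
have [ep [K eK]] := hvec_basis.
set Gm := \matrix_i _.
pose inG v := exists u : 'rV[int]_p, v = u *m Gm.
have inG0 : inG 0 by exists 0; rewrite mul0mx.
have inGD u v : inG u -> inG v -> inG (u + v).
  by move=> [a ->] [b ->]; exists (a + b); rewrite mulmxDl.
have inGB u v : inG u -> inG v -> inG (u - v).
  by move=> [a ->] [b ->]; exists (a - b); rewrite mulmxBl.
have gG s : is_part n s -> inG (g s).
  rewrite -mem_parts => ps; have hi : (index s (parts n) < p)%N by rewrite index_mem.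
  by exists (delta_mx 0 (Ordinal hi)); rewrite -rowE rowK nth_index.
have hG s : is_part n s -> inG (hvec s).
  have [d] := ubnP (n - head 0%N s); elim: d s => // d IH s hd ps.
  have [sp _] := Hg s ps; rewrite -[hvec s](subKr (g s)); apply: (inGB _ _ (gG _ ps)).
  elim: sp => //; first by move=> u v _ ? _ ?; apply: inGB.
  move=> t pt /andP[_ ht]; apply: IH => //.
  have := part_nth_leq 0 pt; rewrite nth0 => tn.
  by clear - hd ht tn; lia.
have [U eU] : exists U : 'M[int]_p, U *m Gm = \matrix_(i < p) hvec (part i).
  have [|f Hf] := @fin_choice _ _ (fun (i : 'I_p) u => hvec (part i) = u *m Gm) 0 (enum 'I_p).
    by move=> i _; apply: hG; apply: partP.
  exists (\matrix_i f i); apply/row_matrixP => i.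
  by rewrite row_mul !rowK Hf ?mem_enum.
have e1 : (K *m U) *m Gm = 1%:M by rewrite -mulmxA eU.
by exists (K *m U); split=> //; apply: mulmx1C_rect e1.
Qed.

Lemma irr_comb1 v : irr_comb v 1%g = ((v *m (irr_deg G)^T) 0 0)%:~R.
Proof.
rewrite sum_cfunE mxE rmorph_sum; apply: eq_bigr => j _.
by rewrite cfunE rmorphM /= mxE irr_degE.
Qed.

Lemma irr_comb_laplacian v :
  irr_comb (v *m ((n.-1)%:Z%:M - M)) = (n%:R - chi_perm) * irr_comb v.
Proof.
have -> : v *m ((n.-1)%:Z%:M - M) = v *+ n - v *m (M + 1%:M).
  rewrite -[v *+ n]scaler_nat -mul_mx_scalar -mulmxBr; congr (_ *m _).
  rewrite opprD addrCA addrC; congr (_ + _); rewrite -raddfB /= natz.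
  by rewrite -[1 : int]/(1%N%:Z) subzn ?subn1 //; exact: ltnW.
by rewrite raddfB raddfMn /= irr_comb_perm mulrBl mulr_natl.
Qed.

Lemma laplacian_char1 : (n%:R - chi_perm) 1%g = 0.
Proof.
rewrite -[n%:R](scaler_nat n (1 : 'CF(G))) !cfunE repr_mx1 mxtrace1 cfun1E group1.
by rewrite mulr1 subrr.
Qed.

Lemma laplacian_deg (v : 'rV[int]_(Nirr G)) : ((v *m ((n.-1)%:Z%:M - M)) *m (irr_deg G)^T) 0 0 = 0.
Proof.
apply: (@intr_inj algC); rewrite -irr_comb1 irr_comb_laplacian.
by rewrite cfunE laplacian_char1 mul0r.
Qed.

(** The degree vector is the regular character, supported at the identity, where n - [chi_perm]
    vanishes. *)
Lemma deg_laplacian : irr_deg G *m ((n.-1)%:Z%:M - M) = 0.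
Proof.
apply: irr_comb_inj; rewrite irr_comb_laplacian raddf0.
have -> : irr_comb (irr_deg G) = cfReg G.
  by rewrite cfReg_sum; apply: eq_bigr => j _; rewrite irr_degE.
apply/cfunP => s; rewrite cfunE cfRegE [RHS]cfunE.
case: eqP => [->|_]; last by rewrite mulr0n mulr0.
by rewrite laplacian_char1 mul0r.
Qed.

End Lattice.

(** * Additive forms on row vectors, and the critical group *)

Definition row_form N (B : 'cV[int]_N) (v : 'rV[int]_N) : int := (v *m B) 0 0.

Lemma row_formB N (B : 'cV[int]_N) u v : row_form B (u - v) = row_form B u - row_form B v.
Proof. by rewrite /row_form mulmxBl !mxE. Qed.

HB.instance Definition _ N (B : 'cV[int]_N) :=
  GRing.isAdditive.Build 'rV[int]_N int (row_form B) (row_formB B).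

Theorem theorem3 (n : nat) (hn : (2 <= n)%N)
  (M : 'M[int]_(Nirr (Sn_group n)))
  (hM : forall i : Iirr (Sn_group n),
      refl_char n * 'chi_i = \sum_j (M i j)%:~R *: 'chi_j) :
  coker_iso (mckay_cartan (n.-1) M)^T
    (fun i : 'I_((npart n - npart n.-1).-1) => (qfac n i.+2)%:Z).
Proof.
have [g Ag [Y [YG GY]]] := chain_basis hn hM.
set Ct := _ - M in Ag; set Gm := \matrix_i _ in YG GY.
(* The indicator column makes [y s] an additive form for every sequence s; on partitions of n it is
   the coordinate at g s. *)
pose y s := row_form (Y *m \col_i (nth [::] (parts n) i == s)%:R).
pose deg := row_form (irr_deg (Sn_group n))^T.
have yE s (i : 'I_(size (parts n))) v :
    s = nth [::] (parts n) i -> y s v = (v *m Y) 0 i.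
  move=> ->; rewrite /y /row_form mulmxA mxE (bigD1 i) //= mxE eqxx mulr1.
  rewrite big1 ?addr0 // => j ji.
  by rewrite [X in _ * X]mxE nth_uniq ?parts_uniq // val_eqE (negbTE ji) mulr0.
have gy v : v = \sum_(s <- parts n) g s *~ y s v.
  rewrite (big_nth [::]) big_mkord -[LHS]mulmx1 -YG mulmxA mulmx_sum_row.
  apply: eq_bigr => i _.
  by rewrite rowK (yE _ i) // -{1}[(_ *m _) 0 i]intz scaler_int.
have yg s t : is_part n s -> is_part n t -> y s (g t) = (s == t)%:R.
  rewrite -!mem_parts => hs ht.
  have hi : (index s (parts n) < size (parts n))%N by rewrite index_mem.
  have hj : (index t (parts n) < size (parts n))%N by rewrite index_mem.
  rewrite (yE _ (Ordinal hi)) ?nth_index //.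
  have -> : g t = row (Ordinal hj) Gm by rewrite rowK nth_index.
  rewrite -row_mul GY !mxE -val_eqE /= eq_sym; congr (_%:R); congr nat_of_bool.
  by apply/eqP/eqP => [e|->//]; rewrite -[s](nth_index [::] hs) e nth_index.
have degA v : deg (v *m Ct) = 0 by apply: laplacian_deg.
have d0 : irr_deg (Sn_group n) 0 0 = 1.
  by apply: (@intr_inj algC); rewrite irr_degE irr0 cfun11.
have deg_neq0 : exists v, deg v != 0.
  exists (delta_mx 0 0).
  by rewrite /deg /row_form -rowE [row _ _ _ _]mxE [(_^T) _ _]mxE d0.
have imP := @imA_iff n _ (mulmxr Ct) g y deg hn Ag gy yg degA deg_neq0.
have sz : size (rtops n) = (npart n - npart n.-1).-1 := size_rtops hn.
have nr (i : 'I_((npart n - npart n.-1).-1)) : nth [::] (rtops n) i \in rtops n.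
  by rewrite mem_nth // sz.
apply: (@coker_iso_delete _ _ Ct (irr_deg (Sn_group n))
  (fun i => phi n y (nth [::] (rtops n) i))).
- exact: d0.
- exact: deg_laplacian.
- exact: degA.
(* Combinations of the g s over [rtops] have degree 0 and take any prescribed values under the
   [phi]; [c'] reindexes c by partitions. *)
- move=> c; pose c' t := if insub (index t (rtops n)) is Some i then c i else 0.
  exists (\sum_(t <- rtops n) g t *~ c' t).
    exact: (@deg_sum_rtops n _ (mulmxr Ct) g deg hn Ag degA).
  move=> i; transitivity (c' (nth [::] (rtops n) i)); first exact: (phi_rtops hn yg).
  by rewrite /c' index_uniq ?rtops_uniq ?sz // valK.
- move=> v; split.
    move=> /imP[dv Hv]; split=> // i.
    by rewrite -modulus_rtops ?sz //; apply: Hv.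
  case=> dv Hv; apply/imP; split=> // s sr.
  have hi : (index s (rtops n) < (npart n - npart n.-1).-1)%N by rewrite -sz index_mem.
  by have := Hv (Ordinal hi); rewrite -modulus_rtops ?sz //= nth_index.
Qed.
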